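(* Let $n\ge1$, $m\ge2$ be integers, $\epsilon\geq 0$, and let $[T_1,\ldots,T_n]$, $T_i\in B(\mathcal H)$, be a row contraction such that $$\left\|\sum_{|\alpha|=m}T_\alpha T_\alpha^*\right\|^{1/2}\le\epsilon\quad\text{and}\quad\sum_{k=0}^\infty\left\|\sum_{|\alpha|=k}T_\alpha T_\alpha^*\right\|^{1/2}<\infty.$$ Then, for each $1\le k\le m-1$, the joint numerical radius satisfies the inequality $$w(T_\alpha:\ |\alpha|=k)\le\cos\left(\frac{\pi}{\left[\frac{m-1}k\right]+2}\right)+3\left[\pi\cos^4\frac{\pi}{2\left(\left[\frac{m-1}k\right]+2\right)}\right]^{1/3}\left(\frac{\epsilon}{\left[\frac{m-1}k\right]+2}\right)^{2/3}.$$
   Context: $\mathcal H$ is a complex Hilbert space. $[x]$ is the integer part of $x$. $\mathbb F_n^+$ is the unital free semigroup on $g_1,\ldots,g_n$ with identity $g_0$; for $\alpha=g_{i_1}\cdots g_{i_k}$, $|\alpha|=k$, $T_\alpha=T_{i_1}\cdots T_{i_k}$; $T_{g_0}=I$. Row contraction: $\sum T_iT_i^*\le I$. Joint numerical radius of $(X_1,\ldots,X_d)\in B(\mathcal H)^{(d)}$: $w(X_1,\ldots,X_d):=\sup\left|\sum_{\beta\in\mathbb F_d^+}\sum_{j=1}^d\langle h_\beta,X_jh_{g_j\beta}\rangle\right|$ over all families $\{h_\beta\}_{\beta\in\mathbb F_d^+}\subset\mathcal H$ with $\sum_\beta\|h_\beta\|^2=1$. $w(T_\alpha:|\alpha|=k)$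 is the joint numerical radius of the $n^k$-tuple of all $T_\alpha$ with $|\alpha|=k$ (in any order). *)

(* Defs.v *)
From HB Require Import structures.
From mathcomp Require Import all_boot all_order all_algebra.
From mathcomp Require Import sesquilinear.
From mathcomp.real_closed Require Export complex.
From mathcomp Require Import all_classical all_reals all_analysis.
From mathcomp.analysis.showcase Require summability.

Set Implicit Arguments.
Unset Strict Implicit.
Unset Printing Implicit Defensive.

Import Order.TTheory GRing.Theory Num.Theory numFieldNormedType.Exports.

Local Open Scope classical_set_scope.
Local Open Scope complex_scope.
Local Open Scope ring_scope.

(* The inner product is linear in its first argument and conjugate-linear in
   the second; [hilbert_dotE] says that it induces the norm, so completeness
   is that of [completeNormedModType]. *)
Record hilbertType (R : realType) := HilbertType {
  hilbert_sort :> completeNormedModType R[i];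
  hilbert_dot : {dot hilbert_sort for (@Num.conj R[i])};
  hilbert_dotE : forall x, hilbert_dot x x = `|x| ^+ 2
}.

Notation "⟨ x , y ⟩" := (@hilbert_dot _ _ x y)
  (at level 0, x at level 99, y at level 99, format "⟨ x ,  y ⟩") : ring_scope.

Section Operators.
Context {R : realType}.

(* In a normed module over R[i] the norm is an R[i]-valued nonnegative real;
   [rnorm] is the same number as an element of R. *)
Definition rnorm {V : normedModType R[i]} (x : V) : R := complex.Re `|x|.

Context {H : hilbertType R}.
Implicit Type A B : H -> H.

Definition bounded_operator A : Prop :=
  linear A /\ exists M : R, forall x, rnorm (A x) <= M * rnorm x.

Definition opnorm A : R := sup [set rnorm (A x) | x in [set x | rnorm x <= 1]].

(* [adjoint A y] is the unique vector y' with <A x, y> = <x, y'> for all x; it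
   exists by the Riesz representation theorem when A is a bounded operator. *)
Definition adjoint A : H -> H :=
  fun y => xget 0 [set y' | forall x, ⟨ A x, y ⟩ = ⟨ x, y' ⟩].

(* The order of R[i] makes this include that both sides are real. *)
Definition operator_le A B : Prop := forall x, ⟨ A x, x ⟩ <= ⟨ B x, x ⟩.

(* The free semigroup on I is [seq I], with product ++ and identity [::]. *)
Definition word_operator {I : Type} (T : I -> H -> H) (alpha : seq I) : H -> H :=
  foldr (fun i A => T i \o A) id alpha.

Definition row_contraction {I : finType} (T : I -> H -> H) : Prop :=
  operator_le (fun x => \sum_i T i (adjoint (T i) x)) id.

Definition word_square_sum {I : finType} (T : I -> H -> H) (k : nat) : H -> H :=
  fun x => \sum_(alpha : k.-tuple I)
    word_operator T alpha (adjoint (word_operator T alpha) x).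

(* The tuple X is indexed by an arbitrary finite type I in place of {1,...,d},
   so that no ordering of the words of length k has to be chosen.
   [summability.sum] is the unconditional sum, i.e., the limit of the finite
   partial sums along the directed set of finite sets of words; here the series
   is absolutely convergent as soon as the X j are bounded. *)
Definition joint_numerical_radius {I : finType} (X : I -> H -> H) : \bar R :=
  ereal_sup
    [set (rnorm (summability.sum (R := R[i]^o)
             (fun beta : seq I => \sum_j ⟨ h beta, X j (h (j :: beta)) ⟩)))%:E
    | h in [set h : seq I -> H |
             \esum_(beta in [set: seq I]) (rnorm (h beta) ^+ 2)%:E = 1%E]].

End Operators.

(* Main.v *)
(** On square-summable families indexed by the words over [J], the words of
    length [k], the operator [(A h)_w = \sum_j X_j h_(jw)] is a contraction
    with [<h, A h>] the quantity defining the joint numerical radius. As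
    [A^j h] is built from words of length [kj], [|A^j| <= eps] once [m <= kj].
    So only one contraction [A] is left, and
    [rho_j = Re <h, A^j h>] is a positive definite sequence
    with [|rho_j| <= eps] for [j >= N - 1].

    For [eps = 0] Fejer's bound [rho_1 <= cos (pi / N)] follows by pairing [rho]
    with the measure with weight [cos (pi / N) - cos t >= 0] at the angles [t]
    such that [e^(iNt) = -1], whose Fourier coefficients of order
    [2, ..., N - 2] vanish. The coefficients of order [>= N - 1] do not decay, so
    they are damped by the autocorrelation of a Hann window of length [L]. This
    costs [O(L^-2)] in the coefficient of order 1 and leaves a tail of size
    [O(eps L / N)]; the choice of [L] that balances them gives the exponent
    [2/3], and the constant only needs [pi <= 27 / 8]. *)
Require Import Defs.
From mathcomp Require Import all_boot all_order all_algebra.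
From mathcomp Require Import finmap sesquilinear.
From mathcomp Require Import all_classical all_reals all_analysis.
From mathcomp.analysis.showcase Require summability.
From mathcomp Require Import ring lra zify.

Set Implicit Arguments.
Unset Strict Implicit.
Unset Printing Implicit Defensive.

Import Order.TTheory GRing.Theory Num.Theory numFieldNormedType.Exports.
Local Open Scope ring_scope.

(** * Trigonometric sums *)

Section Trig.
Context {R : realType}.
Implicit Types (a d t x : R).

Lemma sum_cos_arith a d n :
  2 * sin (d / 2) * (\sum_(i < n) cos (a + i%:R * d))
  = sin (a + n%:R * d - d / 2) - sin (a - d / 2).
Proof.
elim: n => [|n IH]; first by rewrite big_ord0 mulr0 mul0r addr0 subrr.
rewrite big_ord_recr /= mulrDr IH; set t := a + n%:R * d.
have -> : a + n.+1%:R * d - d / 2 = t + d / 2.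
  by rewrite /t -natr1; field.
by rewrite (sinB t) (sinD t); ring.
Qed.

Lemma sinD_nat2pi x k : sin (x + k%:R * (2 * pi)) = sin x.
Proof.
elim: k => [|k IH]; first by rewrite mul0r addr0.
by rewrite -natr1 mulrDl mul1r addrA [2 * pi]mulr_natl sinD2pi -[pi *+ 2]mulr_natl IH.
Qed.

(** Multiplied by [2 * sin (d / 2)] the sum telescopes, and [n] steps of [d] make [k] full turns, so
    the two ends cancel. The bounds on [k] keep [d / 2] strictly between 0 and [pi], where the sine
    does not vanish. *)
Lemma sum_cos_roots a n k : (0 < k < n)%N ->
  \sum_(i < n) cos (a + i%:R * (k%:R * (2 * pi) / n%:R)) = 0.
Proof.
move=> /andP[k0 kn]; set d := k%:R * (2 * pi) / n%:R.
have n0 : n%:R != 0 :> R by rewrite pnatr_eq0 -lt0n (ltn_trans k0).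
have := sum_cos_arith a d n.
have -> : a + n%:R * d - d / 2 = a - d / 2 + k%:R * (2 * pi).
  by rewrite /d; field.
rewrite sinD_nat2pi subrr => /eqP; rewrite !mulf_eq0 => /orP[|/eqP//].
rewrite pnatr_eq0 /= => /eqP s0; exfalso.
suff : 0 < sin (d / 2) by rewrite s0 ltxx.
have dE : d / 2 = pi * (k%:R / n%:R) by rewrite /d; field.
have kn1 : k%:R / n%:R < 1 :> R.
  by rewrite ltr_pdivrMr ?mul1r ?ltr_nat// ltr0n (ltn_trans k0).
have n1 : (0 < n)%N := ltn_trans k0 kn.
apply: sin_gt0_pi; rewrite dE mulr_gt0 ?pi_gt0 ?divr_gt0 ?ltr0n//=.
by rewrite -[ltRHS]mulr1 ltr_pM2l// pi_gt0.
Qed.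

(** The cosine series after the term of degree 4 is grouped into consecutive pairs; for [x <= 2]
    each pair has negative sum. *)
Lemma cos_lt_taylor4 x : 0 < x <= 2 -> cos x < 1 - x ^+ 2 / 2 + x ^+ 4 / 24.
Proof.
move=> /andP[x0 x2].
rewrite -ltrN2; have /cvgN h := @cvg_cos_coeff' R x.
rewrite -(cvg_lim (@Rhausdorff R) h).
apply: (@le_lt_trans _ _ (\sum_(0 <= i < 3) - cos_coeff' x i)).
  do 3 rewrite big_nat_recl//; rewrite big_nil addr0 /cos_coeff' /=.
  rewrite -!exprnP (_ : 0.*2`! = 1)%N// (_ : 1.*2`! = 2)%N//.
  rewrite (_ : 2.*2`! = 24)%N// le_eqVlt; apply/orP; left; apply/eqP.
  by rewrite -!mul2n !muln0 !muln1; field.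
rewrite -seriesN lt_sum_lim_series //.
  by move/cvgP in h; rewrite seriesN.
move=> d; rewrite /cos_coeff' -!exprnP.
rewrite -!(signr_odd _ (3 + _)) !oddD /= odd_double /= expr1 expr0 mulN1r mul1r.
rewrite mulNr opprK subr_gt0 addnS doubleS.
rewrite -[X in x ^+ X]addn2 exprD -mulrA ltr_pM2l ?exprn_gt0//.
rewrite factS factS 2!natrM mulrA invfM !mulrA.
rewrite ltr_pdivrMr ?ltr0n ?fact_gt0// mulVf ?pnatr_eq0 ?gtn_eqF ?fact_gt0//.
rewrite ltr_pdivrMr ?mul1r //.
apply: (@le_lt_trans _ _ (2 ^+ 2)); first by rewrite lerXn2r ?nnegrE// ltW.
by rewrite expr2 -!natrM ltr_nat; lia.
Qed.

Lemma pi_le278 : pi <= 27 / 8 :> R.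
Proof.
have c0 : cos (27 / 16) < 0 :> R.
  apply: lt_le_trans (cos_lt_taylor4 _) _; first lra.
  (* In [u = (27 / 16) ^+ 2] the Taylor bound is [1 - u / 2 + u ^+ 2 / 24], which is negative on
     [[2.8, 3]]. *)
  rewrite (_ : (27 / 16) ^+ 4 = ((27 / 16) ^+ 2) ^+ 2); last by rewrite -exprM.
  have : 3 - 1 / 5 <= (27 / 16) ^+ 2 :> R by rewrite expr2; lra.
  have : (27 / 16) ^+ 2 <= 3 :> R by rewrite expr2; lra.
  by move: ((27 / 16) ^+ 2) => u; nra.
rewrite leNgt; apply/negP => p.
suff : 0 < cos (27 / 16 : R) by rewrite ltNge (ltW c0).
apply: cos_gt0_pihalf; have := @pi_gt0 R; lra.
Qed.

End Trig.

(** * Positive definite sequences *)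

Section Autocorrelation.
Context {R : realType}.
Implicit Types (v w p rho : nat -> R) (M N k : nat).

(** The index [i + k] may exceed [M]; [supp_below M v] makes those terms vanish. *)
Definition autocorr M v k : R := \sum_(i < M) v i * v (i + k)%N.

(* [\sum_(i, j < M) v_i v_j rho_|i - j|], grouped by the difference [k = |i - j|]. *)
Definition toeplitz_form rho M v : R :=
  autocorr M v 0 * rho 0%N + 2 * \sum_(1 <= k < M) autocorr M v k * rho k.

Definition supp_below M v := forall i, (M <= i)%N -> v i = 0.

(** Only real weights are tested; complex exponentials are replaced by a cosine and a sine weight in
    [posdef_cos]. *)
Definition posdef_seq rho := forall M v, supp_below M v -> 0 <= toeplitz_form rho M v.

Lemma autocorrS M v k :
  autocorr M.+1 v k = v 0%N * v k + autocorr M (fun i => v i.+1) k.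
Proof. by rewrite /autocorr big_ord_recl /= add0n. Qed.

Lemma autocorr_out M v k : supp_below M v -> (M <= k)%N -> autocorr M v k = 0.
Proof.
move=> vM Mk; rewrite /autocorr big1// => i _.
by rewrite [v (i + k)%N]vM ?mulr0// (leq_trans Mk)// leq_addl.
Qed.

Lemma toeplitz_formS rho M v : supp_below M.+1 v ->
  toeplitz_form rho M.+1 v =
  v 0%N ^+ 2 * rho 0%N + 2 * v 0%N * (\sum_(i < M) v i.+1 * rho i.+1)
  + toeplitz_form rho M (fun i => v i.+1).
Proof.
move=> vM; set w := fun i => v i.+1.
have wM : supp_below M w by move=> i Mi; apply: vM.
rewrite /toeplitz_form autocorrS -/w.
under eq_bigr do rewrite autocorrS -/w mulrDl.
rewrite big_split /=.
have -> : \sum_(1 <= k < M.+1) autocorr M w k * rho k =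
          \sum_(1 <= k < M) autocorr M w k * rho k.
  case: M vM wM => [|M] vM wM; first by rewrite !big_geq.
  by rewrite big_nat_recr//= (autocorr_out wM)// mul0r addr0.
have -> : \sum_(1 <= k < M.+1) v 0%N * v k * rho k =
          v 0%N * \sum_(i < M) v i.+1 * rho i.+1.
  rewrite big_add1 /= big_mkord mulr_sumr.
  by apply: eq_bigr => i _; rewrite mulrA.
by ring.
Qed.

(** The weights [(1, -1)] turn the form into [2 * (rho 0 - rho 1)]. *)
Lemma posdef_rho1_le rho : posdef_seq rho -> rho 1%N <= rho 0%N.
Proof.
move=> /(_ 2%N (fun i => match i with 0 => 1 | 1 => -1 | _ => 0 end)).
rewrite /toeplitz_form /autocorr !big_nat1 !big_ord_recl !big_ord0 /bump /=.
have H : supp_below 2 (fun i => match i with 0 => 1 | 1 => -1 | _ => 0 end).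
  by case=> [|[|i]].
by move=> /(_ H); lra.
Qed.

(** Add the forms at the weights [p i * cos (i t)] and [p i * sin (i t)]: by the subtraction formula
    for the cosine, the product at indices [i] and [i + k] becomes [cos (k t) * p i * p (i + k)]. *)
Lemma posdef_cos rho M p t : posdef_seq rho -> supp_below M p ->
  0 <= autocorr M p 0 * rho 0%N +
       2 * \sum_(1 <= k < M) cos (k%:R * t) * (autocorr M p k * rho k).
Proof.
move=> pd pM.
have vM : supp_below M (fun i => p i * cos (i%:R * t)).
  by move=> i Mi; rewrite pM ?mul0r.
have wM : supp_below M (fun i => p i * sin (i%:R * t)).
  by move=> i Mi; rewrite pM ?mul0r.
have acE k : autocorr M (fun i => p i * cos (i%:R * t)) k +
     autocorr M (fun i => p i * sin (i%:R * t)) k = cos (k%:R * t) * autocorr M p k.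
  rewrite /autocorr -big_split mulr_sumr /=; apply: eq_bigr => i _.
  have -> : k%:R * t = (i + k)%:R * t - i%:R * t by rewrite natrD; ring.
  by rewrite cosB; ring.
have := addr_ge0 (pd _ _ vM) (pd _ _ wM).
rewrite /toeplitz_form.
set a := (X in X + 2 * _ + _); set b := (X in _ + 2 * X + _).
set a' := (X in _ + (X + _)); set b' := (X in _ + (_ + 2 * X)).
have -> : a + 2 * b + (a' + 2 * b') = (a + a') + 2 * (b + b') by ring.
rewrite /a /a' -mulrDl acE mul0r cos0 mul1r /b /b' -big_split /=.
by under eq_bigr do rewrite -mulrDl acE -mulrA.
Qed.

End Autocorrelation.

(** * Fejer's quadrature at [N] equally spaced angles *)

Section Nodes.
Context {R : realType} (N : nat).
Hypothesis N3 : (3 <= N)%N.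

(* The angles [t] with [e^(iNt) = -1]. *)
Let node (s : nat) : R := pi / N%:R + s%:R * (2 * pi / N%:R).
Let c : R := cos (pi / N%:R).

Let N0 : N%:R != 0 :> R. Proof. by rewrite pnatr_eq0; lia. Qed.
Let N_gt0 : 0 < N%:R :> R. Proof. by rewrite ltr0n; lia. Qed.

Let node_mean (k : nat) : R := N%:R^-1 * \sum_(s < N) cos (k%:R * node s).

(** The cosine coefficients of the discrete measure with mass [(c - cos t) / N] at each node [t],
    which is positive by [cos_node_le]. *)
Definition node_coef (k : nat) : R :=
  N%:R^-1 * \sum_(s < N) (c - cos (node s)) * cos (k%:R * node s).

Lemma cos_node_le (s : nat) : (s < N)%N -> cos (node s) <= c.
Proof.
move=> sN.
(* The reflection [t -> 2 pi - t] exchanges the nodes [s] and [N - 1 - s], so [t] may be taken in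
   [[0, pi]], where the cosine decreases and [pi / N] is the smallest node. *)
wlog sle : s sN / (s.*2 < N)%N => [wl|].
  case: (ltnP s.*2 N) => [|ge]; first exact: wl.
  have -> : cos (node s) = cos (node (N.-1 - s)%N); last by apply: wl; lia.
  rewrite -[LHS]cosN -cosD2pi -mulr_natl /node; congr cos.
  have -> : (N.-1 - s)%:R = N%:R - 1 - s%:R :> R.
    by rewrite natrB; [rewrite -subn1 natrB//; lia|lia].
  by field.
rewrite /c leNgt; apply/negP => lt.
have d0 : 0 < N%:R^-1 :> R by rewrite invr_gt0.
have p0 := @pi_gt0 R.
have sN2 : s%:R * 2 + 1 <= N%:R :> R by rewrite -natrM natr1 ler_nat; lia.
have s0 : 0 <= s%:R :> R by [].
have nodeE : node s = pi * ((s%:R * 2 + 1) / N%:R) by rewrite /node; field.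
have r1 : (s%:R * 2 + 1) / N%:R <= 1 :> R by rewrite ler_pdivrMr// mul1r.
have Ninv1 : N%:R^-1 <= 1 :> R by rewrite invf_le1// ler1n; lia.
have r0 : N%:R^-1 <= (s%:R * 2 + 1) / N%:R :> R.
  by rewrite ler_pdivlMr// mulVf//; lra.
have := lt; rewrite ltr_cos ?in_itv/=; last 2 first.
- by rewrite nodeE; apply/andP; split; nra.
- by apply/andP; split; nra.
by rewrite nodeE ltr_pM2l// ltNge r0.
Qed.

Lemma node_mean0 : node_mean 0 = 1.
Proof.
rewrite /node_mean; under eq_bigr do rewrite mul0r cos0.
by rewrite sumr_const card_ord -mulr_natl mulr1 mulVf.
Qed.

Lemma node_meanN k : (0 < k < N)%N -> node_mean k = 0.
Proof.
move=> kN; rewrite /node_mean -[RHS](mulr0 N%:R^-1); congr (_ * _).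
rewrite -[RHS](sum_cos_roots (k%:R * pi / N%:R) kN).
by apply: eq_bigr => s _; congr cos; rewrite /node; field.
Qed.

(** As [e^(iNt) = -1] at a node, all the coefficients are antiperiodic with period [N]. *)
Lemma cos_nodeDN k s : cos ((k + N)%:R * node s) = - cos (k%:R * node s).
Proof.
have -> : (k + N)%:R * node s = k%:R * node s + pi + s%:R * (2 * pi).
  by rewrite natrD /node; field.
elim: s => [|s _] in k *; first by rewrite mul0r addr0 cosDpi.
elim: s.+1 (k%:R * _) => [|m IH] x; first by rewrite mul0r addr0 cosDpi.
have -> : x + pi + m.+1%:R * (2 * pi) = x + pi + m%:R * (2 * pi) + pi *+ 2.
  by rewrite -natr1 mulr2n; ring.
by rewrite cosD2pi IH.
Qed.

Lemma node_coefDN k : node_coef (k + N) = - node_coef k.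
Proof.
rewrite /node_coef -mulrN -sumrN; congr (_ * _); apply: eq_bigr => s _.
by rewrite cos_nodeDN mulrN.
Qed.

Lemma node_meanD k : node_mean (k + N) = - node_mean k.
Proof.
rewrite /node_mean -mulrN -sumrN; congr (_ * _); apply: eq_bigr => s _.
by rewrite cos_nodeDN.
Qed.

(** The product formula for [cos t * cos (k t)] leaves only means of cosines, known from
    [node_mean0], [node_meanN] and [node_meanD]. *)
Lemma node_coefE k :
  node_coef k.+1 = c * node_mean k.+1 - 2^-1 * (node_mean k.+2 + node_mean k).
Proof.
rewrite /node_coef /node_mean -mulrDr -big_split /= [c * _]mulrCA !mulr_sumr.
rewrite -sumrB; apply: eq_bigr => s _.
move: (node s) => t.
have -> : k.+2%:R * t = k.+1%:R * t + t by rewrite -!natr1; ring.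
have -> : k%:R * t = k.+1%:R * t - t by rewrite -!natr1; ring.
by rewrite cosB cosD; field.
Qed.

Lemma node_coef0 : node_coef 0 = c.
Proof.
rewrite /node_coef; under eq_bigr do rewrite mul0r cos0 mulr1.
rewrite sumrB sumr_const card_ord -[c *+ N]mulr_natl.
have := @node_meanN 1; rewrite /node_mean => /(_ _) h.
rewrite mulrBr mulKf//.
under eq_bigr do rewrite -[node _]mul1r.
by rewrite h ?subr0//; lia.
Qed.

Lemma node_coef1 : node_coef 1 = - 2^-1.
Proof. by rewrite node_coefE node_mean0 !node_meanN ?mulr0; [lra|lia|lia]. Qed.

Lemma node_coef_mid k : (2 <= k)%N -> (k <= N - 2)%N -> node_coef k = 0.
Proof.
case: k => // k k2 kN; rewrite node_coefE !node_meanN ?mulr0; [lra|lia|lia|lia].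
Qed.

Lemma node_coef_last : node_coef N.-1 = 2^-1.
Proof.
have -> : N.-1 = N.-2.+1 by lia.
(* Order [N] wraps around to order 0 with the sign reversed, hence [+ 2^-1] here against [- 2^-1] at
   order 1. *)
rewrite node_coefE (_ : N.-2.+2 = 0 + N)%N; last by lia.
by rewrite node_meanD node_mean0 !node_meanN ?mulr0; [lra|lia|lia].
Qed.

Lemma cos_pi_div_ge0 : 0 <= c.
Proof.
apply: cos_ge0_pihalf; have p0 := @pi_gt0 R.
apply/andP; split.
  by apply: (@le_trans _ _ 0); rewrite ?oppr_le0 divr_ge0 ?ltW.
by rewrite ler_pM2l// lef_pV2 ?posrE// ler_nat; lia.
Qed.

(** Integrates [posdef_cos] against the positive measure on the nodes. *)
Lemma posdef_nodes (rho : nat -> R) M p : posdef_seq rho -> supp_below M p ->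
  0 <= c * (autocorr M p 0 * rho 0%N) +
       2 * \sum_(1 <= k < M) node_coef k * (autocorr M p k * rho k).
Proof.
move=> pd pM.
have : 0 <= \sum_(s < N) N%:R^-1 * (c - cos (node s)) * (autocorr M p 0 * rho 0%N +
       2 * \sum_(1 <= k < M) cos (k%:R * node s) * (autocorr M p k * rho k)).
  apply: sumr_ge0 => s _; apply: mulr_ge0; last exact: posdef_cos.
  by rewrite mulr_ge0 ?invr_ge0// subr_ge0 cos_node_le.
under eq_bigr do rewrite mulrDr.
rewrite big_split /= -mulr_suml -mulr_sumr.
have -> : N%:R^-1 * \sum_(i < N) (c - cos (node i)) = c.
  rewrite -[RHS]node_coef0 /node_coef.
  by under [in RHS]eq_bigr do rewrite mul0r cos0 mulr1.
congr (_ <= _ + _).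
under eq_bigr do rewrite mulrCA mulr_sumr.
rewrite -mulr_sumr exchange_big /=; congr (_ * _).
apply: eq_bigr => k _; move: (_ * rho k) => x; rewrite /node_coef mulr_sumr mulr_suml.
by apply: eq_bigr => s _; ring.
Qed.

Lemma node_coef_normD k Q : `|node_coef (N * Q + k)| = `|node_coef k|.
Proof.
elim: Q => [|Q IH]; first by rewrite muln0.
by rewrite mulnS -addnA addnC node_coefDN normrN IH.
Qed.

(** In each period [|node_coef|] has total mass [1 + c]: it is [1/2] on both sides of a multiple of
    [N], [c] at the multiple and 0 elsewhere. A nonincreasing [r] lets this mass be spread evenly
    over the block before it. The term [2^-1 * r (N * Q).+1] borrows from the next block the half to
    the right of the multiple, so that the induction closes. *)
Lemma block_ineq (r : nat -> R) Q :
  (forall k, 0 <= r k) -> (forall k, r k.+1 <= r k) ->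
  \sum_(1 <= k < (N * Q).+1) r k * `|node_coef k| + 2^-1 * r (N * Q).+1
  <= 2^-1 * r 1%N + (1 + c) / N%:R * \sum_(1 <= k < (N * Q).+1) r k.
Proof.
move=> r0 rS.
have rle i j : (i <= j)%N -> r j <= r i.
  move=> /subnKC<-; elim: (j - i)%N => [|d IH]; rewrite ?addn0//.
  by rewrite addnS (le_trans (rS _)).
elim: Q => [|Q IH]; first by rewrite muln0 !big_geq// mulr0 add0r addr0.
have NQS : (N * Q.+1).+1 = ((N * Q).+1 + N)%N by rewrite mulnS; lia.
have split F : \sum_(1 <= k < (N * Q.+1).+1) F k =
    \sum_(1 <= k < (N * Q).+1) F k + \sum_(j < N) F ((N * Q).+1 + j)%N :> R.
  rewrite (@big_cat_nat _ _ _ (N * Q).+1)//=; last by rewrite NQS leq_addr.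
  by congr (_ + _); rewrite NQS -{1}[(N * Q).+1]add0n big_addn addKn big_mkord;
     apply: eq_bigr => j _; rewrite addnC.
rewrite !split mulrDr.
set B := \sum_(j < N) r _.
set C := \sum_(j < N) _ * _.
set m := (N * Q)%N in IH B C *.
have const_le n F x :
    (forall j, (j < n)%N -> x <= F j) -> n%:R * x <= \sum_(j < n) F j :> R.
  move=> xF; rewrite mulr_natl -[n in x *+ n]card_ord -sumr_const.
  by apply: ler_sum => j _; exact: xF.
have CE : C = 2^-1 * r m.+1 + 2^-1 * r (m + N.-1)%N + c * r (m + N)%N.
  have [n Nn] : exists n, N = n.+3 by exists (N - 3)%N; lia.
  have bE j : `|node_coef (m.+1 + j)%N| = `|node_coef j.+1|.
    by rewrite addSnnS node_coef_normD.
  rewrite /C; under eq_bigr do rewrite bE.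
  rewrite Nn big_ord_recr big_ord_recr big_ord_recl /= addn0 big1 => [|j _]; last first.
    by rewrite node_coef_mid ?normr0 ?mulr0// /bump; have := ltn_ord j; lia.
  have -> : node_coef n.+2 = 2^-1 by rewrite -node_coef_last Nn.
  have -> : node_coef n.+3 = - c by rewrite -node_coef0 -node_coefDN add0n Nn.
  rewrite node_coef1 !normrN !ger0_norm ?cos_pi_div_ge0 ?invr_ge0//.
  by rewrite !addSnnS addr0; ring.
have B1 : N%:R * r (m + N)%N <= B.
  by apply: (const_le N (fun j => r (m.+1 + j)%N)) => j jN; apply: rle; lia.
(* The value at [m + N + 1] lies outside the block and may exceed nothing in it; the first [N - 1]
   values of the block are at least [r (m + N - 1)]. *)
have B2 : N%:R * (r (m + N.-1)%N + r (m + N).+1) <= 2 * B.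
  have BB : (N%:R - 1) * r (m + N.-1)%N + r (m + N)%N <= B.
    have [n Nn] : exists n, N = n.+1 by exists N.-1; lia.
    rewrite /B Nn big_ord_recr /= addSnnS lerD2r -natr1 addrK.
    by apply: (const_le n (fun j => r (m.+1 + j)%N)) => j jN; apply: rle; lia.
  have h1 : r (m + N)%N <= r (m + N.-1)%N by apply: rle; lia.
  have h2 := rS (m + N)%N.
  have h3 : 3 <= N%:R :> R by rewrite ler_nat.
  by have := r0 (m + N).+1; nra.
have -> : r (N * Q.+1).+1 = r (m + N).+1 by congr r; rewrite mulnS addnC.
have c0 := cos_pi_div_ge0.
have : 2^-1 * r (m + N.-1)%N + c * r (m + N)%N + 2^-1 * r (m + N).+1
     <= (1 + c) / N%:R * B.
  rewrite -mulrA [_^-1 * B]mulrC mulrA ler_pdivlMr//; nra.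
by move: IH; rewrite CE; lra.
Qed.

(** [M] blocks cover the support of [r]; in [block_ineq] the term of order 1 equals [2^-1 * r 1] and
    cancels the one on the right. *)
Lemma sum_node_coef_le (r : nat -> R) M :
  (forall k, 0 <= r k) -> (forall k, r k.+1 <= r k) -> supp_below M r ->
  \sum_(2 <= k < M) r k * `|node_coef k| <= (1 + c) / N%:R * \sum_(1 <= k < M) r k.
Proof.
move=> r0 rS rM; have := block_ineq M r0 rS.
have MN : (M <= (N * M).+1)%N by rewrite leqW// leq_pmull//; lia.
have ext F : \sum_(1 <= k < (N * M).+1) r k * F k = \sum_(1 <= k < M) r k * F k.
  case: M rM MN => [|[|M]] rM MN.
  - by rewrite muln0.
  - rewrite (@big_geq _ _ _ 1 1)// big_nat big1// => k /andP[k1 _].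
    by rewrite rM ?mul0r.
  rewrite (@big_cat_nat _ _ _ M.+2)//= [X in _ + X]big_nat [X in _ + X]big1 ?addr0//.
  move=> k /andP[k1 _].
  by rewrite rM ?mul0r.
rewrite ext; under [X in _ <= _ + _ * X]eq_bigr do rewrite -[r _]mulr1.
rewrite (ext (fun=> 1)); under [X in _ <= _ + _ * X]eq_bigr do rewrite mulr1.
case: M rM {MN ext} => [|[|M]] rM.
- by rewrite !big_geq// mulr0.
- by rewrite !big_geq// mulr0.
rewrite [X in X + _ <= _]big_ltn// node_coef1 normrN ger0_norm//.
by have := r0 (N * M.+2).+1; lra.
Qed.

(** In [posdef_nodes] order 1 contributes [- autocorr M p 1 * rho 1]; replacing [autocorr M p 1] by
    [autocorr M p 0] costs at most their difference, since [rho 1 <= rho 0 <= 1]. The orders 2 to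
    [N - 2] drop out and the later ones carry the factor [eps]. *)
Lemma posdef_window_bound (rho : nat -> R) M p eps :
  posdef_seq rho -> rho 0%N <= 1 -> 0 <= eps ->
  (forall k, (N.-1 <= k)%N -> `|rho k| <= eps) ->
  supp_below M p -> (1 < M)%N ->
  (forall k, 0 <= autocorr M p k) ->
  (forall k, autocorr M p k.+1 <= autocorr M p k) ->
  autocorr M p 0 * rho 1%N <= c * autocorr M p 0
    + (autocorr M p 0 - autocorr M p 1)
    + 2 * eps * ((1 + c) / N%:R) * \sum_(1 <= k < M) autocorr M p k.
Proof.
move=> pd rho01 e0 rhoe pM M1 r0 rS.
have := posdef_nodes pd pM; rewrite big_ltn// node_coef1.
have rM : supp_below M (autocorr M p) by move=> i; exact: autocorr_out.
have tail : \sum_(2 <= k < M) node_coef k * (autocorr M p k * rho k) <=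
    eps * \sum_(2 <= k < M) autocorr M p k * `|node_coef k|.
  rewrite mulr_sumr !big_nat; apply: ler_sum => k /andP[k2 _].
  have [kN|kN] := leqP k (N - 2).
    by rewrite node_coef_mid// normr0 !(mul0r,mulr0).
  rewrite [leLHS](_ : _ = autocorr M p k * (node_coef k * rho k)); last by ring.
  rewrite [leRHS](_ : _ = autocorr M p k * (`|node_coef k| * eps)); last by ring.
  apply: ler_wpM2l => //; apply: le_trans (ler_norm _) _.
  by rewrite normrM ler_wpM2l// rhoe//; lia.
have := ler_wpM2l e0 (sum_node_coef_le r0 rS rM).
have c0 := cos_pi_div_ge0.
have := posdef_rho1_le pd; have := r0 0%N; have := rS 0%N.
move: tail; move: (\sum_(_ <= _ < _) _) => X; move: (\sum_(_ <= _ < _) _) => Y.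
move: (\sum_(_ <= _ < _) _) => Z; move: (autocorr M p 0) (autocorr M p 1) => a b.
move: (rho 0%N) (rho 1%N) rho01 => u v u1 XY ba a0 vu h1 h2.
have : c * (a * u) <= c * a by rewrite ler_wpM2l// ler_piMr.
have : (a - b) * v <= a - b by rewrite ler_piMr ?subr_ge0// (le_trans vu).
lra.
Qed.

End Nodes.

(** * The Hann window *)

Section Hann.
Context {R : realType}.

Lemma sin_le_id (x : R) : 0 <= x -> sin x <= x.
Proof.
move=> x0.
have [|c _] := @MVT_segment R sin cos 0 x x0 (fun y _ => is_derive_sin y).
  by apply/continuous_subspaceT => ?; exact: continuous_sin.
rewrite sin0 !subr0 => ->.
by rewrite ler_piMl// cos_le1.
Qed.

Lemma cos_halfE (x : R) : cos x = 1 - 2 * sin (x / 2) ^+ 2.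
Proof.
have e : x / 2 *+ 2 = x by rewrite -mulr_natr divfK.
by rewrite -{1}e cos_mulr2n cos2sin2 -mulr_natr; ring.
Qed.

(** The square is the Toeplitz form of the constant sequence 1. It yields the sum of the
    autocorrelations of a window from the sum of the window. *)
Lemma autocorr_sum M (v : nat -> R) : supp_below M v ->
  (\sum_(i < M) v i) ^+ 2 = autocorr M v 0 + 2 * \sum_(1 <= k < M) autocorr M v k.
Proof.
move=> vM; have toepE w K : toeplitz_form (fun=> 1) K w =
    autocorr K w 0 + 2 * \sum_(1 <= k < K) autocorr K w k.
  by rewrite /toeplitz_form mulr1; under eq_bigr do rewrite mulr1.
rewrite -toepE.
elim: M v vM => [|M IH] v vM.
  by rewrite toepE /autocorr !big_ord0 big_geq//; ring.
rewrite toeplitz_formS// -IH => [|i Mi]; last exact: vM.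
by rewrite big_ord_recl /=; under [X in _ + 2 * _ * X]eq_bigr do rewrite mulr1; ring.
Qed.

Variable L : nat.
Hypothesis L3 : (3 <= L)%N.

Definition hann (i : nat) : R :=
  if (i < L)%N then sin (i%:R * (pi / L%:R)) ^+ 2 else 0.

Let L0 : L%:R != 0 :> R. Proof. by rewrite pnatr_eq0; lia. Qed.
Let L_gt0 : 0 < L%:R :> R. Proof. by rewrite ltr0n; lia. Qed.
Let w : R := pi / L%:R.

Let w_gt0 : 0 < w. Proof. by rewrite divr_gt0 ?pi_gt0. Qed.

Lemma hann_sin i : (i <= L)%N -> hann i = sin (i%:R * w) ^+ 2.
Proof.
rewrite /hann -/w leq_eqVlt => /predU1P[->|->//].
by rewrite ltnn mulrC divfK// sinpi expr0n.
Qed.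

Lemma hannE i : (i <= L)%N -> hann i = (1 - cos (i%:R * (2 * w))) / 2.
Proof.
move=> iL; rewrite hann_sin// cos_halfE.
rewrite (_ : i%:R * (2 * w) / 2 = i%:R * w); last by field.
by field.
Qed.

Lemma hann_ge0 i : 0 <= hann i.
Proof. by rewrite /hann; case: ifP => // _; exact: sqr_ge0. Qed.

Lemma supp_hann : supp_below L hann.
Proof. by move=> i Li; rewrite /hann ltnNge Li. Qed.

Lemma hann0 : hann 0 = 0.
Proof. by rewrite hann_sin// mul0r sin0 expr0n. Qed.

(** The identity [sin^2 a - sin^2 b = sin (a + b) sin (a - b)], which exposes the signs of
    increments. *)
Lemma hann_sub j i : (i <= L)%N -> (j <= L)%N ->
  hann i - hann j = sin ((i + j)%:R * w) * sin (i%:R * w - j%:R * w).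
Proof.
move=> iL jL; rewrite !hann_sin// natrD mulrDl sinB sinD.
move: (cos2Dsin2 (i%:R * w)) (cos2Dsin2 (j%:R * w)).
set s := sin _; set u := cos _; set s' := sin _; set u' := cos _ => e e'.
rewrite [RHS](_ : _ = s ^+ 2 * u' ^+ 2 - u ^+ 2 * s' ^+ 2); last by ring.
by rewrite -[u ^+ 2](addrK (s ^+ 2)) e -[u' ^+ 2](addrK (s' ^+ 2)) e'; ring.
Qed.

Let sin_nat_ge0 i : (i <= L)%N -> 0 <= sin (i%:R * w).
Proof.
move=> iL; apply: sin_ge0_pi; rewrite mulr_ge0 ?(ltW w_gt0)//=.
by rewrite /w mulrCA ler_piMr ?pi_ge0// ler_pdivrMr// mul1r ler_nat.
Qed.

Lemma hannS_ge j : (j.*2.+1 <= L)%N -> hann j <= hann j.+1.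
Proof.
move=> jL; rewrite -subr_ge0 hann_sub; [|lia|lia].
have -> : j.+1%:R * w - j%:R * w = 1%:R * w by rewrite -natr1; ring.
by rewrite mulr_ge0 ?sin_nat_ge0//; lia.
Qed.

(** The window is symmetric under [j -> L - j], which carries its falling half to the rising one. *)
Lemma hannS_le j : (L <= j.*2.+1)%N -> hann j.+1 <= hann j.
Proof.
move=> jL; have [jL'|jL'] := leqP L j; first by rewrite !supp_hann// ltnW.
have -> : hann j = hann (L - j).
  rewrite !hann_sin ?leq_subr//; last exact: ltnW.
  rewrite natrB; last exact: ltnW.
  by rewrite mulrBl [L%:R * w]mulrC divfK// sinB sinpi cospi; ring.
have -> : hann j.+1 = hann (L - j.+1).
  rewrite !hann_sin ?leq_subr//.
  by rewrite natrB// mulrBl [L%:R * w]mulrC divfK// sinB sinpi cospi; ring.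
have -> : (L - j)%N = (L - j.+1).+1 by lia.
by apply: hannS_ge; lia.
Qed.

Lemma sum_shift (u v : nat -> R) k : supp_below L v ->
  \sum_(j < L) v j * (if (k <= j)%N then u (j - k)%N else 0)
  = \sum_(i < L) u i * v (i + k)%N.
Proof.
move=> vL; pose F j := v j * (if (k <= j)%N then u (j - k)%N else 0).
rewrite -[LHS](big_mkord xpredT F) -(big_mkord xpredT (fun i => u i * v (i + k)%N)).
have -> : \sum_(0 <= j < L) F j = \sum_(0 <= j < L + k) F j.
  rewrite [RHS](@big_cat_nat _ _ _ L)//=; last exact: leq_addr.
  rewrite [X in _ + X]big_nat [X in _ + X]big1 ?addr0// => i /andP[Li _].
  by rewrite /F vL ?mul0r.
rewrite (@big_cat_nat _ _ _ k)//=; last exact: leq_addl.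
rewrite big_nat big1 ?add0r => [|i /andP[_ ik]]; last first.
  by rewrite /F leqNgt ik mulr0.
rewrite -{1}[k]add0n big_addn addnK; apply: eq_bigr => i _.
by rewrite /F leq_addl addnK mulrC.
Qed.

Lemma autocorr_hann_ge0 k : 0 <= autocorr L hann k.
Proof. by apply: sumr_ge0 => i _; rewrite mulr_ge0 ?hann_ge0. Qed.

(* Twice the difference is [\sum_j (p_j - p_(j+1)) (p_(j-k) - p_(j+1+k))]; both
   factors have the same sign since [p] is symmetric and unimodal. *)
Lemma autocorr_hann_noninc k : autocorr L hann k.+1 <= autocorr L hann k.
Proof.
rewrite -subr_ge0 -(pmulr_rge0 _ (ltr0n R 2)).
pose q j := if (k <= j)%N then hann (j - k) else 0.
have E1 : \sum_(j < L) hann j * q j = autocorr L hann k.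
  exact: sum_shift supp_hann.
have E2 : \sum_(j < L) hann j.+1 * q j = autocorr L hann k.+1.
  rewrite (@sum_shift hann (hann \o S)) => [|i Li]; last by rewrite /= supp_hann// ltnW.
  by apply: eq_bigr => i _; rewrite /= addnS.
have E3 : \sum_(j < L) hann j.+1 * hann (j.+1 + k) = autocorr L hann k.
  rewrite /autocorr -(big_mkord xpredT (fun i => hann i * hann (i + k))).
  rewrite big_ltn; last by lia.
  rewrite hann0 mul0r add0r big_add1 big_mkord.
  have -> : L = L.-1.+1 by lia.
  rewrite big_ord_recr /= (_ : hann L.-1.+1 = 0) ?mul0r ?addr0//.
  by apply: supp_hann; lia.
have -> : 2 * (autocorr L hann k - autocorr L hann k.+1) =
    \sum_(j < L) (hann j - hann j.+1) * (q j - hann (j.+1 + k)).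
  under eq_bigr do rewrite mulrBl !mulrBr opprB.
  rewrite !big_split /= !sumrN E1 E2 E3.
  rewrite (_ : \sum_(i < L) hann i * hann (i.+1 + k) = autocorr L hann k.+1).
    by ring.
  by apply: eq_bigr => i _; rewrite addSnnS.
apply: sumr_ge0 => j _; rewrite /q.
case: (leqP k j) => kj; case: (leqP (j.+1 + k) L) => jk.
- rewrite hann_sub; [|lia|lia]; rewrite hann_sub; [|lia|lia].
  have -> : j%:R * w - j.+1%:R * w = - (1%:R * w) by rewrite -natr1; ring.
  have -> : (j - k)%:R * w - (j.+1 + k)%:R * w = - (k.*2.+1%:R * w).
    by rewrite natrB// -mul2n natrD -!natr1 natrM; ring.
  have -> : (j - k + (j.+1 + k))%N = (j + j.+1)%N by lia.
  (* Both increments contain the same sine [a], so its sign does not matter. *)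
  rewrite !sinN; set a := sin ((j + j.+1)%:R * w).
  rewrite [leRHS](_ : _ = a ^+ 2 * (sin (1%:R * w) * sin (k.*2.+1%:R * w))).
    2: by ring.
  apply: mulr_ge0; first exact: sqr_ge0.
  by apply: mulr_ge0; apply: sin_nat_ge0; lia.
- rewrite [hann (_ + k)]supp_hann ?subr0; last exact: ltnW.
  by rewrite mulr_ge0 ?hann_ge0// subr_ge0 hannS_le//; lia.
- by rewrite sub0r mulrN -mulNr opprB mulr_ge0 ?hann_ge0// subr_ge0 hannS_ge//; lia.
- by rewrite [hann (_ + k)]supp_hann ?subr0 ?mulr0// ltnW.
Qed.

Let sum_cos_w a k : (0 < k < 3)%N -> \sum_(i < L) cos (a + i%:R * (k%:R * (2 * w))) = 0.
Proof.
move=> k3; rewrite -[RHS](@sum_cos_roots R a L k); last by lia.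
by apply: eq_bigr => i _; rewrite /w !mulrA.
Qed.

Let sum_const (x : R) : \sum_(i < L) x = L%:R * x.
Proof. by rewrite sumr_const card_ord mulr_natl. Qed.

Lemma sum_hann : \sum_(i < L) hann i = L%:R / 2.
Proof.
transitivity (\sum_(i < L) (2^-1 - 2^-1 * cos (0 + i%:R * (1%:R * (2 * w))))).
  by apply: eq_bigr => i _; rewrite hannE ?add0r ?mul1r; [field | apply: ltnW].
by rewrite sumrB -mulr_sumr sum_cos_w// mulr0 subr0 sum_const.
Qed.

(** Linearized into cosines of orders 0, 1 and 2, the summand keeps only its constant term; the
    others sum to 0 because 1 and 2 are below [L]. The same holds for [autocorr_hann1]. *)
Lemma autocorr_hann0 : autocorr L hann 0 = 3 * L%:R / 8.
Proof.
transitivity (\sum_(i < L) (3 / 8 - 2^-1 * cos (0 + i%:R * (1%:R * (2 * w)))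
   + 8^-1 * cos (0 + i%:R * (2%:R * (2 * w))))).
  apply: eq_bigr => i _; rewrite addn0 hannE ?add0r ?mul1r; last exact: ltnW.
  have -> : i%:R * (2%:R * (2 * w)) = (i%:R * (2 * w)) *+ 2 by rewrite mulr2n; ring.
  by rewrite cos_mulr2n -mulr_natr; field.
rewrite big_split sumrB /= -!mulr_sumr !sum_cos_w// !mulr0 subr0 addr0 sum_const; ring.
Qed.

Lemma autocorr_hann1 : autocorr L hann 1 = L%:R / 4 + L%:R / 8 * cos (2 * w).
Proof.
transitivity (\sum_(i < L) (4^-1 + 8^-1 * cos (2 * w)
   - 4^-1 * cos (0 + i%:R * (1%:R * (2 * w)))
   - 4^-1 * cos (2 * w + i%:R * (1%:R * (2 * w)))
   + 8^-1 * cos (2 * w + i%:R * (2%:R * (2 * w))))).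
  apply: eq_bigr => i _; rewrite !hannE ?add0r ?mul1r ?addn1//; last exact: ltnW.
  set t := i%:R * (2 * w).
  have -> : i.+1%:R * (2 * w) = t + 2 * w by rewrite -natr1 /t; ring.
  have -> : 2 * w + i%:R * (2%:R * (2 * w)) = t + (t + 2 * w) by rewrite /t; ring.
  have -> : cos (2 * w) = cos (t + 2 * w - t) by congr cos; ring.
  rewrite [cos (_ - _)]cosB [cos (t + (_ + _))]cosD [2 * w + t]addrC.
  by move: (cos _) (cos _) (sin _) (sin _) => a b d e; field.
rewrite !(big_split, sumrB, sumrN) /= -!mulr_sumr !sum_cos_w//.
by rewrite !mulr0 !subr0 addr0 !sum_const; ring.
Qed.

End Hann.

(** * Choice of the window length *)

Section Bound.
Context {R : realType}.
Variables (N : nat) (rho : nat -> R) (eps : R).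
Hypotheses (N3 : (3 <= N)%N) (pd : posdef_seq rho) (rho01 : rho 0%N <= 1).
Hypotheses (eps0 : 0 <= eps) (rhoe : forall k, (N.-1 <= k)%N -> `|rho k| <= eps).

Let c : R := cos (pi / N%:R).
Let B : R := 2 * eps * ((1 + c) / N%:R).

(** [posdef_window_bound] divided by [autocorr L hann 0 = 3 L / 8]. The gap to order 1 is
    [L / 4 * sin (pi / L) ^+ 2], and [autocorr_sum] evaluates the tail. *)
Lemma posdef_hann_bound L : (3 <= L)%N ->
  rho 1%N <= c + 2 / 3 * (pi / L%:R) ^+ 2 + B * (L%:R / 3 - 1 / 2).
Proof.
move=> L3; have L0 : 0 < L%:R :> R by rewrite ltr0n; lia.
have := posdef_window_bound N3 pd rho01 eps0 rhoe (@supp_hann R L) _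
  (@autocorr_hann_ge0 R L) (autocorr_hann_noninc L3).
move=> /(_ _); rewrite -/c -/B => h.
have := autocorr_sum (@supp_hann R L); rewrite sum_hann//.
have : autocorr L (@hann R L) 0 - autocorr L (@hann R L) 1
    <= L%:R / 4 * (pi / L%:R) ^+ 2.
  rewrite autocorr_hann0// autocorr_hann1// cos_halfE.
  rewrite (_ : 2 * (pi / L%:R) / 2 = pi / L%:R); last by rewrite mulrC mulKf.
  have : sin (pi / L%:R) ^+ 2 <= (pi / L%:R : R) ^+ 2.
    have pL0 : 0 <= pi / L%:R :> R by rewrite divr_ge0 ?pi_ge0.
    have s0 : 0 <= sin (pi / L%:R : R).
      apply: sin_ge0_pi; rewrite pL0 /=.
      by rewrite ler_piMr ?pi_ge0// invf_le1// ler1n; lia.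
    by rewrite lerXn2r ?nnegrE// sin_le_id.
  by rewrite mulrC; nra.
move: h => /(_ ltac:(lia)).
rewrite autocorr_hann0//; move: (\sum_(_ <= _ < _) _) => S h d e.
have SE : S = (3 * L%:R / 8) * (L%:R / 3 - 1 / 2) by lra.
rewrite -(ler_pM2l (_ : 0 < 3 * L%:R / 8)); last by lra.
apply: le_trans h _; rewrite SE.
rewrite !mulrDr; move: d; move: ((pi / L%:R) ^+ 2) => u d.
lra.
Qed.

Lemma posdef_bound :
  rho 1%N <= cos (pi / N%:R)
    + 3 * (pi * cos (pi / (2 * N%:R)) ^+ 4) `^ (1 / 3) * (eps / N%:R) `^ (2 / 3).
Proof.
have N0 : 0 < N%:R :> R by rewrite ltr0n; lia.
have p0 := @pi_gt0 R; have p2 := @pi_ge2 R; have p278 := @pi_le278 R.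
have c0 : 0 <= c by exact: cos_pi_div_ge0.
have c1 : c <= 1 by exact: cos_le1.
have cc : cos (pi / (2 * N%:R)) ^+ 2 = (1 + c) / 2 :> R.
  have -> : c = cos ((pi / (2 * N%:R)) *+ 2).
    by rewrite /c -mulr_natr; congr cos; field; rewrite gt_eqF.
  by rewrite cos_mulr2n -mulr_natr; field.
rewrite -/c -mulrA; set y := _ `^ _ * _.
have y0 : 0 <= y by rewrite mulr_ge0 ?powR_ge0.
(* Cubing removes the fractional powers; the half-angle formula gives
   [B = 4 * eps * cos (pi / (2 N)) ^+ 2 / N]. *)
have y3 : y ^+ 3 = pi * B ^+ 2 / 16.
  have powX3 (a e : R) : (a `^ e) ^+ 3 = a `^ (e * 3%:R).
    by rewrite powRrM powR_mulrn ?powR_ge0.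
  rewrite /y exprMn !powX3.
  have -> : 1 / 3 * 3%:R = 1 :> R by field.
  have -> : 2 / 3 * 3%:R = 2%:R :> R by field.
  rewrite powRr1; last by rewrite mulr_ge0 ?exprn_even_ge0// ltW.
  rewrite powR_mulrn; last by rewrite divr_ge0// ltW.
  rewrite (exprM _ 2 2) cc /B; field; by rewrite gt_eqF.
have B0 : 0 <= B by rewrite /B !mulr_ge0 ?invr_ge0 ?addr_ge0 ?(ltW N0)//.
have hb := posdef_hann_bound.
clearbody y B c.
have rho1 : rho 1%N <= 1 := le_trans (posdef_rho1_le pd) rho01.
have [B00|Bneq] := eqVneq B 0.
  have -> : y = 0.
    by apply/eqP; have /eqP := y3; rewrite B00 expr0n /= mulr0 mul0r expf_eq0.
  rewrite mulr0 addr0 leNgt; apply/negP => lt.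
  have d0 : 0 < rho 1%N - c by rewrite subr_gt0.
  (* Without a tail term, long windows exclude any excess of [rho 1] over [c]; 9 is an upper bound
     for [2 / 3 * pi ^+ 2]. *)
  have := archi_boundP (ltW (divr_gt0 (ltr0n R 9) d0)).
  move: (Num.bound _) => L; rewrite ltr_pdivrMr// => h.
  have := hb L.+3 isT; rewrite B00 mul0r addr0.
  have L30 : 1 <= L.+3%:R :> R by rewrite ler1n.
  have LL : L%:R <= L.+3%:R :> R.
    rewrite ler_nat.
    exact: leq_addl 3 L.
  move: LL L30 h; move: (L.+3%:R) (L%:R) => l l' LL l1 h.
  have : 2 / 3 * (pi / l) ^+ 2 < rho 1%N - c; last by lra.
  have l0 : 0 < l by lra.
  rewrite (_ : 2 / 3 * (pi / l) ^+ 2 = (2 / 3 * pi ^+ 2) / l ^+ 2); last first.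
    by field; rewrite gt_eqF.
  rewrite ltr_pdivrMr ?exprn_gt0//.
  have : pi ^+ 2 <= 13 :> R by nra.
  have : 9 < l * (rho 1%N - c) by nra.
  by nra.
have Bpos : 0 < B by rewrite lt_neqAle eq_sym Bneq.
(* With [x] as window length the tail term is exactly [2 * y]. *)
pose x := 6 * y / B.
have x0 : 0 <= x by rewrite /x divr_ge0 ?mulr_ge0.
have ypos : 0 < y.
  rewrite lt_neqAle y0 andbT eq_sym; apply/eqP => y00.
  have : 0 < y ^+ 3 by rewrite y3 divr_gt0 ?mulr_gt0 ?exprn_gt0.
  by rewrite y00 expr0n ltxx.
have xpos : 0 < x by rewrite /x divr_gt0 ?mulr_gt0.
(* Here [x] is too short for a window, but then [y >= 9 / 16 * pi], so that [3 * y] alone exceeds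
   1. *)
have [x2|x2] := leP x 2.
  apply: (le_trans rho1).
  have yB : 3 * y <= B by move: x2; rewrite /x ler_pdivrMr//; lra.
  have : 9 * y ^+ 2 <= B ^+ 2 by nra.
  rewrite exprS in y3 => h.
  have : 9 / 16 * pi * y ^+ 2 <= y * y ^+ 2 by rewrite y3; nra.
  by rewrite ler_pM2r ?exprn_gt0// => h2; nra.
have /andP[Lx xL] := truncn_itv x0.
set L := (Num.truncn x).+1 in xL.
have L3 : (3 <= L)%N by rewrite -(ltr_nat R) (lt_trans x2).
have Lx1 : L%:R <= x + 1 by rewrite -natr1; lra.
apply: (le_trans (hb _ L3)).
rewrite -addrA lerD2l.
(* Rounding [x] up to [L] adds at most [1 / 3], which the [- 1 / 2] absorbs. *)
have h1 : B * (L%:R / 3 - 1 / 2) <= 2 * y.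
  have : B * (L%:R / 3 - 1 / 2) <= B * (x / 3) by rewrite ler_pM2l//; lra.
  suff -> : B * (x / 3) = 2 * y by [].
  by rewrite /x; field.
have h2 : 2 / 3 * (pi / L%:R) ^+ 2 <= y.
  have : (pi / L%:R) ^+ 2 <= (pi / x) ^+ 2.
    have Lpos : 0 < L%:R :> R by apply: lt_trans xL.
    have le : pi / L%:R <= pi / x by rewrite ler_pM2l// lef_pV2 ?posrE// ltW.
    have ge : 0 <= pi / L%:R :> R by rewrite divr_ge0 ?ltW.
    by rewrite lerXn2r ?nnegrE// (le_trans ge).
  suff : 2 / 3 * (pi / x) ^+ 2 <= y by lra.
  (* By [y3] the claim becomes [pi ^+ 2 <= 54 / 16 * pi], that is [pi <= 27 / 8]. *)
  have -> : 2 / 3 * (pi / x) ^+ 2 = pi ^+ 2 * B ^+ 2 / (54 * y ^+ 2).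
    by rewrite /x; field; rewrite Bneq gt_eqF.
  rewrite ler_pdivrMr ?mulr_gt0 ?exprn_gt0//.
  rewrite (_ : y * (54 * y ^+ 2) = 54 * y ^+ 3); last by ring.
  rewrite y3; by have := mulr_gt0 p0 (exprn_gt0 2 Bpos); nra.
lra.
Qed.

End Bound.

(** * Adjoints and rows of operators *)

Section TupleSums.

Lemma big_tuple_nil (V : nmodType) (I : finType) (F : seq I -> V) :
  \sum_(alpha : 0.-tuple I) F alpha = F [::].
Proof.
by rewrite (big_pred1 [tuple]) => // t; apply/esym/eqP; rewrite (tuple0 t).
Qed.

Lemma big_tuple_cons (V : nmodType) (I : finType) l (F : seq I -> V) :
  \sum_(alpha : l.+1.-tuple I) F alpha =
  \sum_i \sum_(alpha : l.-tuple I) F (i :: alpha).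
Proof.
rewrite pair_big /=.
rewrite (reindex (fun p : I * l.-tuple I => [tuple of p.1 :: p.2])) //=.
exists (fun t : l.+1.-tuple I => (thead t, [tuple of behead t])) => [[i a] _|t _] /=.
  by congr pair; apply: val_inj.
by rewrite -tuple_eta.
Qed.

End TupleSums.

Section Hilbert.
Local Open Scope classical_set_scope.
Local Open Scope complex_scope.
Local Open Scope ring_scope.
Context {R : realType} {H : hilbertType R}.
Implicit Types (x y z : H) (A : H -> H) (a : R) (u : R[i]).

Definition rdot x y : R := complex.Re ⟨ x, y ⟩.

Lemma normC_rnorm x : `|x| = (rnorm x)%:C.
Proof.
have := normr_ge0 x; rewrite /rnorm; case: `|x| => r i.
by rewrite lecE /= => /andP[/eqP -> _].
Qed.

Lemma rnorm_ge0 x : 0 <= rnorm x.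
Proof. by have := normr_ge0 x; rewrite normC_rnorm lecR. Qed.

Lemma rdotxx x : rdot x x = rnorm x ^+ 2.
Proof. by rewrite /rdot hilbert_dotE normC_rnorm -rmorphXn. Qed.

Lemma dotC x y : ⟨ x, y ⟩ = (⟨ y, x ⟩)^*.
Proof. by rewrite hermC expr0 mul1r. Qed.

Lemma rdotC x y : rdot x y = rdot y x.
Proof. by rewrite /rdot dotC; case: ⟨ _, _ ⟩. Qed.

Lemma rdotDl x y z : rdot (x + y) z = rdot x z + rdot y z.
Proof. by rewrite /rdot linearDl raddfD. Qed.

Lemma rdotDr x y z : rdot z (x + y) = rdot z x + rdot z y.
Proof. by rewrite !(rdotC z) rdotDl. Qed.

Lemma rdot_suml (I : Type) (r : seq I) (P : pred I) (F : I -> H) y :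
  rdot (\sum_(i <- r | P i) F i) y = \sum_(i <- r | P i) rdot (F i) y.
Proof. by rewrite /rdot linear_sumlz raddf_sum. Qed.

Lemma dotZl u x y : ⟨ u *: x, y ⟩ = u * ⟨ x, y ⟩.
Proof. exact: linearZl_LR. Qed.

Lemma dotZr u x y : ⟨ x, u *: y ⟩ = u^* * ⟨ x, y ⟩.
Proof. by rewrite dotC dotZl [in RHS]dotC rmorphM. Qed.

Lemma rdotZl a x y : rdot (a%:C *: x) y = a * rdot x y.
Proof. by rewrite /rdot dotZl; case: ⟨ _, _ ⟩ => r s /=; ring. Qed.

Lemma rdotZr a x y : rdot x (a%:C *: y) = a * rdot x y.
Proof. by rewrite rdotC rdotZl rdotC. Qed.

Lemma rdotNl x y : rdot (- x) y = - rdot x y.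
Proof. by rewrite /rdot linearNl raddfN. Qed.

Lemma rdotNr x y : rdot x (- y) = - rdot x y.
Proof. by rewrite rdotC rdotNl rdotC. Qed.

Lemma rnormZ u x : rnorm (u *: x) = complex.Re `|u| * rnorm x.
Proof.
by rewrite {1}/rnorm normrZ normC_rnorm; case: `|u| => r i /=; rewrite mulr0 subr0.
Qed.

Lemma rnorm0_eq0 x : rnorm x = 0 -> x = 0.
Proof. by move=> x0; apply/eqP; rewrite -normr_eq0 normC_rnorm x0. Qed.

Lemma rdot_young x y e : 0 < e -> 2 * rdot x y <= e * rnorm x ^+ 2 + rnorm y ^+ 2 / e.
Proof.
move=> e0; have : 0 <= rdot (e%:C *: x - y) (e%:C *: x - y).
  by rewrite rdotxx sqr_ge0.
rewrite rdotDl !rdotDr !rdotNl !rdotNr !rdotZl !rdotZr !rdotxx (rdotC y x).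
move=> h; rewrite -(ler_pM2l e0) mulrDr [e * (_ / e)]mulrC divfK ?gt_eqF//.
by move: h; lra.
Qed.

(** Young's inequality at its optimal weight [rnorm y / rnorm x]. *)
Lemma rdot_le x y : rdot x y <= rnorm x * rnorm y.
Proof.
have := rnorm_ge0 x; have := rnorm_ge0 y.
rewrite le_eqVlt => /predU1P[y0|y0].
  move: y0 => /esym y0 _; rewrite y0 mulr0.
  by rewrite (rnorm0_eq0 y0) /rdot linear0r.
rewrite le_eqVlt => /predU1P[/esym x0|x0].
  by rewrite x0 mul0r (rnorm0_eq0 x0) /rdot linear0l.
have := rdot_young x y (divr_gt0 y0 x0).
have -> : rnorm y / rnorm x * rnorm x ^+ 2 + rnorm y ^+ 2 / (rnorm y / rnorm x) =
  2 * (rnorm x * rnorm y) by field; rewrite !gt_eqF.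
by rewrite ler_pM2l.
Qed.

Lemma dot_eq x y : (forall z, ⟨ z, x ⟩ = ⟨ z, y ⟩) -> x = y.
Proof.
move=> xy; apply/eqP; rewrite -subr_eq0; apply/eqP/rnorm0_eq0.
apply/eqP; rewrite -(sqrf_eq0 (rnorm _)) -rdotxx /rdot linearBr /=.
by rewrite xy subrr.
Qed.

(* The representing vector is the limit along the filter of almost minimizers
   of [J x = |x|^2 - 2 Re (f x)], which is Cauchy by the parallelogram law. *)
Lemma riesz (f : H -> R[i]) (K : R) :
  (forall x y, f (x + y) = f x + f y) -> (forall u x, f (u *: x) = u * f x) ->
  (forall x, complex.Re (f x) <= K * rnorm x) -> exists y, forall x, f x = ⟨ x, y ⟩.
Proof.
move=> fD fZ fK.
pose g x := complex.Re (f x).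
have gD x y : g (x + y) = g x + g y by rewrite /g fD raddfD.
have gZ a x : g (a%:C *: x) = a * g x.
  by rewrite /g fZ; case: (f x) => r s /=; ring.
pose J x := rnorm x ^+ 2 - 2 * g x.
pose S := [set J x | x in [set: H]].
have Sinf : has_inf S.
  split; first by exists (J 0), 0.
  exists (- K ^+ 2) => _ [x _ <-]; rewrite /J.
  by have := fK x; have := sqr_ge0 (rnorm x - K); rewrite /g !expr2; lra.
pose j := inf S.
have Jj x : j <= J x by apply: ge_inf; [case: Sinf | exists x].
have JD z x : J (x + z) = J x + 2 * (rdot z x - g z) + rnorm z ^+ 2.
  by rewrite /J -!rdotxx gD rdotDl !rdotDr (rdotC x z); ring.
have gap x y : rnorm (x - y) ^+ 2 <= 2 * (J x - j) + 2 * (J y - j).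
  have := Jj ((2^-1 : R)%:C *: (x + y)).
  have -> : J ((2^-1 : R)%:C *: (x + y)) =
     (2 * J x + 2 * J y - rnorm (x - y) ^+ 2) / 4.
    rewrite /J gZ gD -!rdotxx rdotZl rdotZr !rdotDl !rdotDr !rdotNl !rdotNr (rdotC y x).
    by field.
  by lra.
pose F := filter_from [set e : R | 0 < e] (fun e => [set x | J x <= j + e]).
have FF : ProperFilter F.
  apply: filter_from_proper => [|e /= e0]; last first.
    have [_ [x _ <-] /ltW le] := inf_adherent e0 Sinf; by exists x.
  apply: filter_from_filter; first by exists 1 => /=.
  move=> a b /= a0 b0; exists (Num.min a b); first by rewrite /= lt_min a0.
  move=> x /= le; split; apply: (le_trans le); rewrite lerD2l ge_min lexx ?orbT//.
have Fc : cauchy F.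
  apply: cauchy_exP => e e0.
  have [d d0 ed] : exists2 d : R, 0 < d & e = d%:C.
    by case: e e0 => a b; rewrite ltcE /= => /andP[/eqP -> a0]; exists a.
  (* By [gap], two points within [d ^+ 2 / 8] of the infimum have squared distance at most
     [d ^+ 2 / 2]. *)
  pose e1 := d ^+ 2 / 8.
  have e10 : 0 < e1 by rewrite divr_gt0// exprn_gt0.
  have [_ [x _ <-] /ltW xe] := inf_adherent e10 Sinf.
  exists x, e1 => // y /= ye; rewrite -ball_normE /= ed normC_rnorm ltcR.
  rewrite -(ltr_pXn2r (ltn0Sn 1)) ?nnegrE ?rnorm_ge0 ?(ltW d0)//.
  by have := gap x y; rewrite /e1 -/j in xe ye e10 *; lra.
have Fl : F --> lim F by apply: cauchy_cvg.
set l := lim F in Fl.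
have key z : rdot z l = g z.
  have small e : 0 < e -> `|rdot z l - g z| <= e * (rnorm z + 1 + rnorm z ^+ 2).
    move=> e0.
    have [x [xe xl]] : exists x, J x <= j + e ^+ 2 /\ rnorm (l - x) < e.
      have : F ([set x | J x <= j + e ^+ 2] `&` ball l e%:C).
        apply: filterI; first by exists (e ^+ 2) => //=; exact: exprn_gt0.
        by apply: Fl; apply: nbhsx_ballx; rewrite ltcR.
      move=> /filter_ex [x [xe]]; rewrite -ball_normE /= normC_rnorm ltcR => xl.
      by exists x.
    (* Moving from [x] along [z] lowers [J] by at most [e ^+ 2]; the choices [t = e] and [t = - e]
       then bound the first variation by a multiple of [e]. *)
    have h t : 0 <= e ^+ 2 + 2 * t * (rdot z x - g z) + t ^+ 2 * rnorm z ^+ 2.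
      have := Jj (x + t%:C *: z); rewrite JD gZ rdotZl -(rdotxx (t%:C *: z)).
      rewrite rdotZl rdotZr rdotxx; lra.
    have h1 : `|rdot z l - rdot z x| <= rnorm z * e.
      have -> : rdot z l - rdot z x = rdot z (l - x) by rewrite rdotDr rdotNr.
      have le := ler_wpM2l (rnorm_ge0 z) (ltW xl).
      rewrite ler_norml lerNl -rdotNl !(le_trans (rdot_le _ _))//.
      by rewrite /rnorm normrN.
    have h2 : `|rdot z x - g z| <= e * (1 + rnorm z ^+ 2).
      have := h e; have := h (- e); have := sqr_ge0 (rnorm z).
      move: (rdot z x - g z) (rnorm z ^+ 2) => a b b0 h3 h4.
      by rewrite ler_norml; apply/andP; split; rewrite -(ler_pM2l e0); nra.
    have -> : rdot z l - g z = (rdot z l - rdot z x) + (rdot z x - g z) by ring.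
    by apply: (le_trans (ler_normD _ _)); lra.
  apply/eqP; rewrite -subr_eq0 -normr_le0.
  set c := rnorm z + 1 + rnorm z ^+ 2 in small.
  have c0 : 0 < c by rewrite /c; have := rnorm_ge0 z; have := sqr_ge0 (rnorm z); lra.
  apply/ler_addgt0Pr => e e0; rewrite add0r.
  have := small (e / c) (divr_gt0 e0 c0); by rewrite divfK ?gt_eqF.
exists l => x; apply/eqP; rewrite eq_complex -/(g x) -/(rdot x l) key eqxx /=.
(* The real part at ['i *: x] gives the imaginary part at [x]. *)
have := key ('i *: x); rewrite /rdot /g dotZl fZ.
case: ⟨ x, l ⟩ => a b; case: (f x) => a' b' /=.
by rewrite !mul0r !mul1r !sub0r => /oppr_inj ->.
Qed.

Lemma linearD_of A : linear A -> forall x y, A (x + y) = A x + A y.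
Proof. by move=> Al x y; rewrite -[x]scale1r Al !scale1r. Qed.

Lemma linear0_of A : linear A -> A 0 = 0.
Proof. by move=> Al; have := Al (-1) 0 0; rewrite scaler0 addr0 scaleN1r addNr. Qed.

Lemma linearZ_of A : linear A -> forall (a : R[i]) x, A (a *: x) = a *: A x.
Proof. by move=> Al a x; rewrite -[a *: x]addr0 Al (linear0_of Al) addr0. Qed.

Lemma linear_sum_of A : linear A ->
  forall (I : Type) (r : seq I) (P : pred I) (F : I -> H),
  A (\sum_(i <- r | P i) F i) = \sum_(i <- r | P i) A (F i).
Proof.
move=> Al I r P F; apply: (big_morph A); first exact: linearD_of.
exact: linear0_of.
Qed.

(** The Riesz theorem excludes the default value of [xget]. *)
Lemma adjointP (A : H -> H) : bounded_operator A ->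
  forall x y, ⟨ A x, y ⟩ = ⟨ x, adjoint A y ⟩.
Proof.
move=> [Al [M AM]] x y; rewrite /adjoint; case: xgetP => [z -> /(_ x)//|no].
exfalso.
pose f (u : H) := ⟨ A u, y ⟩.
have fD (v w : H) : f (v + w) = f v + f w by rewrite /f linearD_of// linearDl.
have fZ (a : R[i]) (u : H) : f (a *: u) = a * f u by rewrite /f linearZ_of// dotZl.
have fK (u : H) : complex.Re (f u) <= M * rnorm y * rnorm u.
  by apply: (le_trans (rdot_le _ _)); rewrite mulrAC ler_wpM2r ?rnorm_ge0.
have [y' Hy'] := riesz fD fZ fK.
by apply: (no y') => u; exact: Hy'.
Qed.

End Hilbert.

Section Rows.
Local Open Scope classical_set_scope.
Local Open Scope complex_scope.
Local Open Scope ring_scope.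
Context {R : realType} {H : hilbertType R}.
Implicit Types (x y z : H) (A B : H -> H) (k l m : nat).

Lemma rnorm0 : rnorm (0 : H) = 0. Proof. by rewrite /rnorm normr0. Qed.

Lemma rnormD x y : rnorm (x + y) <= rnorm x + rnorm y.
Proof. by have := ler_normD x y; rewrite !normC_rnorm -raddfD lecR. Qed.

Lemma rnormZr (a : R) x : rnorm (a%:C *: x) = `|a| * rnorm x.
Proof. by rewrite rnormZ normc_def /= expr0n addr0 sqrtr_sqr. Qed.

Lemma adjointZ A (u : R[i]) x : bounded_operator A ->
  adjoint A (u *: x) = u *: adjoint A x.
Proof.
by move=> Ab; apply: dot_eq => z; rewrite -(adjointP Ab) !dotZr (adjointP Ab).
Qed.

Lemma rnorm_adjoint_le A M x : bounded_operator A -> 0 <= M ->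
  (forall y, rnorm (A y) <= M * rnorm y) -> rnorm (adjoint A x) <= M * rnorm x.
Proof.
move=> Ab M0 AM; have := rnorm_ge0 (adjoint A x).
rewrite le_eqVlt => /predU1P[<-|p]; first by rewrite mulr_ge0 ?rnorm_ge0.
rewrite -(ler_pM2l p) -expr2 -rdotxx /rdot -(adjointP Ab).
apply: (le_trans (rdot_le _ _)).
by rewrite mulrA [_ * M]mulrC ler_wpM2r ?rnorm_ge0.
Qed.

Lemma opnorm_bound A M : 0 <= M -> (forall x, rnorm (A x) <= M * rnorm x) ->
  (forall (a : R) x, A (a%:C *: x) = a%:C *: A x) ->
  forall x, rnorm (A x) <= opnorm A * rnorm x.
Proof.
move=> M0 AM AZ x; have := rnorm_ge0 x.
rewrite le_eqVlt => /predU1P[/esym x0|x0]; first by have := AM x; rewrite x0 !mulr0.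
rewrite -ler_pdivrMr//.
have -> : rnorm (A x) / rnorm x = rnorm (A ((rnorm x)^-1%:C *: x)).
  by rewrite AZ rnormZr ger0_norm ?invr_ge0 ?(ltW x0)// mulrC.
apply: ub_le_sup.
  exists M => _ [y /= y1 <-]; apply: (le_trans (AM y)).
  by rewrite -[leRHS]mulr1 ler_wpM2l.
exists ((rnorm x)^-1%:C *: x) => //=.
by rewrite rnormZr ger0_norm ?invr_ge0 ?(ltW x0)// mulVf ?gt_eqF.
Qed.

Lemma bounded_operatorP A : bounded_operator A ->
  exists2 M, 0 <= M & forall x, rnorm (A x) <= M * rnorm x.
Proof.
move=> [_ [M AM]]; exists `|M| => // x; apply: (le_trans (AM x)).
by rewrite ler_wpM2r ?rnorm_ge0 ?ler_norm.
Qed.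

Lemma bounded_operator_comp A B :
  bounded_operator A -> bounded_operator B -> bounded_operator (A \o B).
Proof.
move=> Ab Bb; have [M M0 AM] := bounded_operatorP Ab.
have [K _ BK] := bounded_operatorP Bb.
split=> [a x y /=|]; first by rewrite (proj1 Bb) (proj1 Ab).
exists (M * K) => x; apply: (le_trans (AM _)); rewrite -mulrA ler_wpM2l//.
Qed.

Lemma bounded_operator_id : bounded_operator (id : H -> H).
Proof. by split=> //; exists 1 => x; rewrite mul1r. Qed.

(* Young's inequality with weight kappa makes |v|^2 reappear on the right with
   coefficient 1, so no square roots are needed. *)
Lemma row_norm_le (I : finType) (S : I -> H -> H) (kappa : R) :
  (forall i, bounded_operator (S i)) -> 0 <= kappa ->
  (forall y, rdot (\sum_i S i (adjoint (S i) y)) y <= kappa * rnorm y ^+ 2) ->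
  forall x : I -> H, rnorm (\sum_i S i (x i)) ^+ 2 <= kappa * \sum_i rnorm (x i) ^+ 2.
Proof.
move=> Sb k0 SK x; set v := \sum_i S i (x i).
set s := \sum_i rnorm (x i) ^+ 2.
have s0 : 0 <= s by apply: sumr_ge0 => i _; exact: sqr_ge0.
(* A weight [e > kappa] is positive even when [kappa = 0], so it can be divided by. *)
suff main e : kappa < e -> rnorm v ^+ 2 <= e * s.
  apply/ler_addgt0Pr => e e0.
  have d0 : 0 < e / (s + 1) by rewrite divr_gt0//; lra.
  apply: (le_trans (main (kappa + e / (s + 1)) _)); first by lra.
  rewrite mulrDl lerD2l -mulrA ler_piMr ?(ltW e0)//.
  by rewrite ler_pdivrMl; lra.
move=> ke; have e0 : 0 < e by lra.
have E1 : rnorm v ^+ 2 = \sum_i rdot (x i) (adjoint (S i) v).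
  rewrite -rdotxx {1}/v rdot_suml; apply: eq_bigr => i _.
  by rewrite /rdot (adjointP (Sb i)).
have E2 : \sum_i rnorm (adjoint (S i) v) ^+ 2 <= e * rnorm v ^+ 2.
  apply: (@le_trans _ _ (kappa * rnorm v ^+ 2)); last first.
    by rewrite ler_wpM2r ?sqr_ge0// ltW.
  apply: le_trans (SK v); rewrite rdot_suml le_eqVlt; apply/orP; left; apply/eqP.
  by apply: eq_bigr => i _; rewrite -rdotxx /rdot (adjointP (Sb i)).
have : 2 * rnorm v ^+ 2 <= e * s + e^-1 * (e * rnorm v ^+ 2).
  rewrite {1}E1 mulr_sumr.
  apply: (@le_trans _ _ (e * s + e^-1 * \sum_i rnorm (adjoint (S i) v) ^+ 2)).
    rewrite /s !mulr_sumr -big_split /=; apply: ler_sum => i _.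
    by rewrite [_^-1 * _]mulrC; exact: rdot_young.
  by rewrite lerD2l ler_wpM2l// invr_ge0 ltW.
by rewrite mulKf ?gt_eqF//; lra.
Qed.

Section Words.
Variables (I : finType) (T : I -> H -> H).
Hypotheses (Tb : forall i, bounded_operator (T i)) (Tr : row_contraction T).

Lemma bounded_word alpha : bounded_operator (word_operator T alpha).
Proof.
elim: alpha => [|i alpha IH] /=; first exact: bounded_operator_id.
exact: (bounded_operator_comp (Tb i) IH).
Qed.

Lemma row_contraction_norm (x : I -> H) :
  rnorm (\sum_i T i (x i)) ^+ 2 <= \sum_i rnorm (x i) ^+ 2.
Proof.
rewrite -[leRHS]mul1r; apply: row_norm_le => // y; rewrite mul1r -rdotxx /rdot.
by have := Tr y; rewrite lecE => /andP[].
Qed.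

Lemma word_row_norm m eps : Num.sqrt (opnorm (word_square_sum T m)) <= eps ->
  forall x : m.-tuple I -> H,
  rnorm (\sum_(alpha : m.-tuple I) word_operator T alpha (x alpha)) ^+ 2
  <= eps ^+ 2 * \sum_alpha rnorm (x alpha) ^+ 2.
Proof.
move=> le; apply: (row_norm_le (S := fun alpha : m.-tuple I => word_operator T alpha)).
- by move=> alpha; exact: bounded_word.
- exact: sqr_ge0.
move=> y; rewrite -/(word_square_sum T m y).
(* Any crude bound will do: it makes the set under [sup] in [opnorm] bounded above. *)
have [M M0 wM] : exists2 M, 0 <= M &
    forall x, rnorm (word_square_sum T m x) <= M * rnorm x.
  have /boolp.choice [M MP] : forall alpha : m.-tuple I, exists M, 0 <= M /\
      forall x, rnorm (word_operator T alpha x) <= M * rnorm x.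
    move=> alpha.
    by have [M M0 MB] := bounded_operatorP (bounded_word alpha); exists M.
  exists (\sum_alpha M alpha * M alpha).
    by apply: sumr_ge0 => alpha _; rewrite mulr_ge0// (proj1 (MP _)).
  move=> x; rewrite /word_square_sum mulr_suml.
  elim/big_ind2 : _ => [|a b a' b' h h'|alpha _]; first by rewrite rnorm0.
    by apply: le_trans (rnormD _ _) _; exact: lerD.
  have [M0 MB] := MP alpha; apply: (le_trans (MB _)); rewrite -mulrA ler_wpM2l//.
  by apply: rnorm_adjoint_le => //; exact: bounded_word.
have wZ (a : R) x : word_square_sum T m (a%:C *: x) = a%:C *: word_square_sum T m x.
  rewrite /word_square_sum scaler_sumr; apply: eq_bigr => alpha _.
  have b := bounded_word alpha.
  by rewrite adjointZ// (linearZ_of (proj1 b)).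
apply: (le_trans (rdot_le _ _)); rewrite expr2 mulrA ler_wpM2r ?rnorm_ge0//.
apply: (le_trans (opnorm_bound M0 wM wZ y)); rewrite ler_wpM2r ?rnorm_ge0//.
have [op0|op0] := leP (opnorm (word_square_sum T m)) 0.
  exact: le_trans op0 (sqr_ge0 _).
rewrite -(sqr_sqrtr (ltW op0)) lerXn2r ?nnegrE ?sqrtr_ge0//.
exact: le_trans (sqrtr_ge0 _) le.
Qed.

End Words.
End Rows.

(** * Positive definite sequences from contractions *)

Section PositiveDefinite.
Local Open Scope classical_set_scope.
Local Open Scope complex_scope.
Local Open Scope ring_scope.
Context {R : realType} {V : lmodType R[i]}.
Variables (A : V -> V) (B : V -> V -> R).
Hypotheses (AD : forall x y, A (x + y) = A x + A y)
  (AZ : forall (a : R) x, A (a%:C *: x) = a%:C *: A x).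
Hypotheses (BDl : forall x y z, B (x + y) z = B x z + B y z)
  (BZl : forall (a : R) x z, B (a%:C *: x) z = a * B x z)
  (BC : forall x y, B x y = B y x) (B0 : forall x, 0 <= B x x)
  (BA : forall x, B (A x) (A x) <= B x x).

Let comb (M : nat) (v : nat -> R) h := \sum_(i < M) (v i)%:C *: iter i A h.

Let A0 : A 0 = 0.
Proof. by have := AZ 0 0; rewrite !scale0r. Qed.

Let combS M v h : comb M.+1 v h = (v 0%N)%:C *: h + A (comb M (fun i => v i.+1) h).
Proof.
rewrite /comb big_ord_recl /=; congr (_ + _).
rewrite (big_morph A AD A0); apply: eq_bigr => i _.
by rewrite AZ.
Qed.

(* By induction the form dominates the squared norm of [\sum_i v_i A^i h]. *)
Lemma posdef_contraction h : posdef_seq (fun k => B h (iter k A h)).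
Proof.
set rho := fun k => _; move=> M v vM.
apply: le_trans (B0 (comb M v h)) _.
elim: M v vM => [|M IH] v vM.
  rewrite /comb big_ord0 /toeplitz_form /autocorr big_ord0 big_geq//.
  have -> : B 0 0 = 0 by rewrite -{1}(scale0r (0 : V)) (BZl 0) mul0r.
  by rewrite mul0r mulr0 addr0.
rewrite toeplitz_formS// combS.
set v' := fun i => v i.+1; set g := comb M v' h.
have vM' : supp_below M v' by move=> i Mi; apply: vM.
have BDr x y z : B z (x + y) = B z x + B z y by rewrite !(BC z) BDl.
have BZr a x z : B z (a%:C *: x) = a * B z x by rewrite BC BZl BC.
have -> : \sum_(i < M) v i.+1 * rho i.+1 = B h (A g).
  rewrite /g /comb (big_morph A AD A0).
  have Bh0 : B h 0 = 0 by rewrite -(scale0r (0 : V)) (BZr 0) mul0r.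
  rewrite (big_morph (B h) (fun x y => BDr x y h) Bh0).
  by apply: eq_bigr => i _; rewrite AZ BZr.
rewrite BDl !BDr !BZl !BZr (BC (A g) h).
(* The contraction property replaces [A g] by [g], to which induction applies; the other terms match
   [toeplitz_formS]. *)
have := le_trans (BA g) (IH v' vM').
by rewrite /rho /=; lra.
Qed.

End PositiveDefinite.

(** * Vectors built from words of operators *)

Section RowWord.
Local Open Scope classical_set_scope.
Local Open Scope complex_scope.
Local Open Scope ring_scope.
Context {R : realType} {H : hilbertType R} {I : finType}.
Variable T : I -> H -> H.
Hypotheses (Tb : forall i, bounded_operator (T i)) (Tr : row_contraction T).

(* [row_word l v s]: v is a sum of T_alpha y_alpha over the words of length l,
   for some vectors with sum of squared norms at most s. *)
Fixpoint row_word (l : nat) (v : H) (s : R) : Prop :=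
  if l is l'.+1 then
    exists (y : I -> H) (t : I -> R),
      [/\ v = \sum_i T i (y i), \sum_i t i <= s & forall i, row_word l' (y i) (t i)]
  else rnorm v ^+ 2 <= s.

Lemma row_word_norm l v s : row_word l v s -> rnorm v ^+ 2 <= s.
Proof.
elim: l v s => [//|l IH] v s [y [t [-> ts yt]]].
apply: (le_trans (row_contraction_norm Tb Tr y)); apply: le_trans ts.
by apply: ler_sum => i _; exact: IH (yt i).
Qed.

(** The nested sums are cut at depth [m]; by [row_word_norm] each inner sum is a vector obeying the
    same bound. *)
Lemma row_word_collapse m b v s : row_word (m + b) v s -> row_word m v s.
Proof.
elim: m v s => [|m IH] v s; first exact: row_word_norm.
by move=> [y [t [vy ts yt]]]; exists y, t; split => // i; exact: IH (yt i).
Qed.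

Lemma row_word_tuple l v s : row_word l v s ->
  exists2 y : seq I -> H, v = \sum_(alpha : l.-tuple I) word_operator T alpha (y alpha)
    & \sum_(alpha : l.-tuple I) rnorm (y alpha) ^+ 2 <= s.
Proof.
elim: l v s => [|l IH] v s.
  move=> /= vs; exists (fun=> v).
    by rewrite (big_tuple_nil (fun w => word_operator T w v)).
  by rewrite (big_tuple_nil (fun=> rnorm v ^+ 2)).
move=> [y [t [-> ts yt]]].
have /boolp.choice [z zP] : forall i, exists z : seq I -> H,
    y i = \sum_(alpha : l.-tuple I) word_operator T alpha (z alpha) /\
    \sum_(alpha : l.-tuple I) rnorm (z alpha) ^+ 2 <= t i.
  by move=> i; have [z] := IH _ _ (yt i); exists z.
pose y' (w : seq I) := if w is i :: w' then z i w' else 0.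
exists y'.
  rewrite (big_tuple_cons l (fun w => word_operator T w (y' w))).
  apply: eq_bigr => i _; rewrite (zP i).1.
  by rewrite (linear_sum_of (proj1 (Tb i))).
rewrite (big_tuple_cons l (fun w => rnorm (y' w) ^+ 2)).
by apply: le_trans ts; apply: ler_sum => i _; exact: (zP i).2.
Qed.

Lemma row_word_sum k b (y : seq I -> H) (t : seq I -> R) :
  (forall alpha, row_word b (y alpha) (t alpha)) ->
  row_word (k + b) (\sum_(alpha : k.-tuple I) word_operator T alpha (y alpha))
     (\sum_(alpha : k.-tuple I) t alpha).
Proof.
elim: k y t => [|k IH] y t yt.
  rewrite (big_tuple_nil (fun w => word_operator T w (y w))) (big_tuple_nil t).
  exact: yt.
exists (fun i => \sum_(alpha : k.-tuple I) word_operator T alpha (y (i :: alpha))).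
exists (fun i => \sum_(alpha : k.-tuple I) t (i :: alpha)); split.
- rewrite (big_tuple_cons k (fun w => word_operator T w (y w))).
  by apply: eq_bigr => i _; rewrite (linear_sum_of (proj1 (Tb i))).
- by rewrite (big_tuple_cons k t).
- by move=> i; exact: (IH (fun w => y (i :: w)) (fun w => t (i :: w))).
Qed.

Lemma row_word0 l : row_word l 0 0.
Proof.
elim: l => [|l IH] /=; first by rewrite rnorm0 expr0n.
exists (fun=> 0), (fun=> 0); split => //; last by rewrite big1.
by rewrite big1// => i _; rewrite (linear0_of (proj1 (Tb i))).
Qed.

Lemma row_wordZ l (u : R[i]) v s : complex.Re `|u| <= 1 ->
  row_word l v s -> row_word l (u *: v) s.
Proof.
move=> u1; elim: l v s => [|l IH] v s /=.
  have u0 : 0 <= complex.Re `|u| by have := normr_ge0 u; rewrite lecE => /andP[].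
  apply: le_trans; rewrite rnormZ lerXn2r ?nnegrE ?mulr_ge0 ?rnorm_ge0//.
  by rewrite ler_piMl ?rnorm_ge0.
move=> [y [t [-> ts yt]]]; exists (fun i => u *: y i), t.
split => // [|i]; last exact: IH (yt i).
by rewrite scaler_sumr; apply: eq_bigr => i _; rewrite (linearZ_of (proj1 (Tb i))).
Qed.

Lemma row_word_small m eps : Num.sqrt (opnorm (word_square_sum T m)) <= eps ->
  forall b v s, row_word (m + b) v s -> rnorm v ^+ 2 <= eps ^+ 2 * s.
Proof.
move=> le b v s /row_word_collapse /row_word_tuple [y -> ys].
apply: (le_trans (word_row_norm Tb le (fun alpha => y alpha))).
by rewrite ler_wpM2l ?sqr_ge0.
Qed.

End RowWord.

(** * The backward shift on words *)

Section ShortWords.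
Local Open Scope classical_set_scope.
Local Open Scope complex_scope.
Local Open Scope ring_scope.
Context {J : finType}.

(** These finite sets exhaust the words and every finite set lies in one of them, so they control
    unconditional sums. *)
Fixpoint words_below (D : nat) : seq (seq J) :=
  if D is D'.+1 then words_below D' ++ [seq tval t | t <- enum {: D'.-tuple J}]
  else [::].

Lemma mem_words_below D w : (w \in words_below D) = (size w < D)%N.
Proof.
elim: D => [//|D IH] /=; rewrite mem_cat IH ltnS [RHS]leq_eqVlt orbC; congr (_ || _).
apply/mapP/eqP => [[t _ ->]|/eqP sw]; first exact: size_tuple.
by exists (Tuple sw); rewrite ?mem_enum.
Qed.

Lemma words_below_uniq D : uniq (words_below D).
Proof.
elim: D => [//|D IH] /=; rewrite cat_uniq IH (map_inj_uniq val_inj) enum_uniq andbT.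
apply/hasPn => w /mapP[t _ ->]; rewrite mem_words_below size_tuple ltnn //.
Qed.

Lemma sum_words_below (V : nmodType) D (F : seq J -> V) :
  \sum_(w <- words_below D) F w = \sum_(d < D) \sum_(beta : d.-tuple J) F beta.
Proof.
elim: D => [|D IH] /=; first by rewrite big_nil big_ord0.
by rewrite big_cat IH big_ord_recr /= big_map big_enum.
Qed.

End ShortWords.

Section Truncation.
Local Open Scope classical_set_scope.
Local Open Scope complex_scope.
Local Open Scope ring_scope.
Context {J : finType} {V : nmodType}.
Variable D : nat.

(** Truncation keeps every sum finite, and the shift on words remains a contraction. *)
Definition cut (g : seq J -> V) (w : seq J) : V := if (size w < D)%N then g w else 0.

End Truncation.

Section TailSum.
Local Open Scope classical_set_scope.
Local Open Scope complex_scope.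
Local Open Scope ring_scope.
Context {R : realType} {J : finType}.
Variable D : nat.

Definition tail_sum (s : seq J -> R) (w : seq J) : R := \sum_j cut D s (j :: w).

Lemma tail_sum_ge0 s : (forall w, 0 <= s w) -> forall w, 0 <= tail_sum s w.
Proof. by move=> s0 w; apply: sumr_ge0 => j _; rewrite /cut; case: ifP. Qed.

(** Each nonempty word is [j :: w] in exactly one way, so only the weight of the empty word is lost;
    the layer of length [D] is removed by [cut]. *)
Lemma sum_tail_sum_le s : (forall w, 0 <= s w) ->
  \sum_(w <- words_below D) tail_sum s w <= \sum_(w <- words_below D) s w.
Proof.
move=> s0; rewrite !sum_words_below.
pose G d := \sum_(beta : d.-tuple J) cut D s beta.
have -> : \sum_(d < D) \sum_(beta : d.-tuple J) tail_sum s beta = \sum_(d < D) G d.+1.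
  apply: eq_bigr => d _; rewrite /G (big_tuple_cons d (cut D s)) /tail_sum.
  by rewrite exchange_big.
have -> : \sum_(d < D) \sum_(beta : d.-tuple J) s beta = \sum_(d < D.+1) G d.
  rewrite big_ord_recr /= [G D]big1 ?addr0 => [|b _]; last first.
    by rewrite /cut size_tuple ltnn.
  by apply: eq_bigr => d _; apply: eq_bigr => b _; rewrite /cut size_tuple ltn_ord.
rewrite big_ord_recl /= lerDr; apply: sumr_ge0 => b _; rewrite /cut; case: ifP => //.
Qed.

End TailSum.

Section BackwardShift.
Local Open Scope classical_set_scope.
Local Open Scope complex_scope.
Local Open Scope ring_scope.
Context {R : realType} {H : hilbertType R} {I : finType}.
Variables (T : I -> H -> H) (k D : nat) (u : R[i]).
Hypotheses (Tb : forall i, bounded_operator (T i)) (Tr : row_contraction T).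
Hypothesis u1 : complex.Re `|u| <= 1.
Let J : finType := k.-tuple I.

(** The scalar [u] is a phase, chosen later to make the quantity to be bounded real and
    nonnegative. *)
Definition back_shift (g : seq J -> H) (w : seq J) : H :=
  u *: \sum_(j : J) word_operator T j (cut D g (j :: w)).

(** Only semidefinite, as it ignores words of length at least [D]; [posdef_contraction] asks for no
    more. *)
Definition sum_dot (g g' : seq J -> H) : R :=
  \sum_(w <- words_below D) rdot (g w) (g' w).

Lemma back_shiftD (g g' : seq J -> H) :
  back_shift (g + g') = back_shift g + back_shift g'.
Proof.
apply/funext => w; rewrite [RHS](_ : _ = back_shift g w + back_shift g' w)//.
rewrite /back_shift -scalerDr -big_split /=; congr (_ *: _).
apply: eq_bigr => j _; rewrite -(linearD_of (proj1 (bounded_word Tb j))) /cut.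
by case: ifP; rewrite ?addr0.
Qed.

Lemma back_shiftZ (a : R[i]) (g : seq J -> H) : back_shift (a *: g) = a *: back_shift g.
Proof.
apply/funext => w; rewrite [RHS](_ : _ = a *: back_shift g w)//.
rewrite /back_shift scalerA mulrC -scalerA; congr (_ *: _).
rewrite scaler_sumr; apply: eq_bigr => j _.
rewrite -(linearZ_of (proj1 (bounded_word Tb j))) /cut.
by case: ifP; rewrite ?scaler0.
Qed.

(** Each shift puts [k] more operators in front, while [tail_sum] carries the squared norms
    along. *)
Lemma row_word_iter_back_shift (h : seq J -> H) j w :
  row_word T (k * j) (iter j back_shift h w)
     (iter j (tail_sum D) (fun w => rnorm (h w) ^+ 2) w).
Proof.
elim: j w => [|j IH] w; first by rewrite muln0 /=.
rewrite mulnS iterS; apply: row_wordZ => //.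
(* [row_word_sum] expects families on all words; lengths other than [k] get the value 0. *)
pose y (a : seq I) : H := if insub a is Some j' then
  cut D (iter j back_shift h) ((j' : J) :: w) else 0.
pose t (a : seq I) : R := if insub a is Some j' then
  cut D (iter j (tail_sum D) (fun w => rnorm (h w) ^+ 2)) ((j' : J) :: w) else 0.
have := @row_word_sum _ _ _ T Tb k (k * j) y t.
have -> : \sum_(alpha : k.-tuple I) word_operator T alpha (y alpha) =
   \sum_(j0 : J) word_operator T j0 (cut D (iter j back_shift h) (j0 :: w)).
  by apply: eq_bigr => a _; rewrite /y valK.
have -> : \sum_(alpha : k.-tuple I) t alpha =
   tail_sum D (iter j (tail_sum D) (fun w => rnorm (h w) ^+ 2)) w.
  by apply: eq_bigr => a _; rewrite /t valK.
apply=> a; rewrite /y /t; case: insub => [j'|]; last exact: row_word0.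
by rewrite /cut; case: ifP => _; [exact: IH | exact: row_word0].
Qed.

Lemma iter_tail_sum (h : seq J -> H) j :
  \sum_(w <- words_below D) iter j (tail_sum D) (fun w => rnorm (h w) ^+ 2) w
  <= sum_dot h h.
Proof.
rewrite /sum_dot; under [leRHS]eq_bigr do rewrite rdotxx.
elim: j => [//|j IH]; apply: le_trans IH; rewrite iterS; apply: sum_tail_sum_le.
by elim: j => [|j IH] w /=; [exact: sqr_ge0 | exact: tail_sum_ge0].
Qed.

Lemma back_shift_contraction h : sum_dot (back_shift h) (back_shift h) <= sum_dot h h.
Proof.
apply: le_trans (iter_tail_sum h 1); apply: ler_sum => w _; rewrite rdotxx.
exact: (row_word_norm Tb Tr (row_word_iter_back_shift h 1 w)).
Qed.

Lemma iter_back_shift_small m eps h j :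
  Num.sqrt (opnorm (word_square_sum T m)) <= eps -> (m <= k * j)%N ->
  sum_dot (iter j back_shift h) (iter j back_shift h) <= eps ^+ 2 * sum_dot h h.
Proof.
move=> le mkj; apply: (@le_trans _ _ (eps ^+ 2 * \sum_(w <- words_below D)
   iter j (tail_sum D) (fun w => rnorm (h w) ^+ 2) w)); last first.
  by rewrite ler_wpM2l ?sqr_ge0 ?iter_tail_sum.
rewrite mulr_sumr; apply: ler_sum => w _; rewrite rdotxx.
have := row_word_iter_back_shift h j w; rewrite -(subnKC mkj).
exact: (row_word_small Tb Tr le).
Qed.

Lemma sum_dot_young g g' e : 0 < e ->
  2 * sum_dot g g' <= e * sum_dot g g + sum_dot g' g' / e.
Proof.
move=> e0; rewrite /sum_dot mulr_suml !mulr_sumr -big_split; apply: ler_sum => w _.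
by rewrite !rdotxx; exact: rdot_young.
Qed.

Lemma sum_dotNr g g' : sum_dot g (- g') = - sum_dot g g'.
Proof. by rewrite /sum_dot -sumrN; apply: eq_bigr => w _; rewrite fctE rdotNr. Qed.

Lemma sum_dotxx_ge0 g : 0 <= sum_dot g g.
Proof. by apply: sumr_ge0 => w _; rewrite rdotxx sqr_ge0. Qed.

Lemma sum_dot_le g g' e : 0 <= e -> sum_dot g g <= 1 -> sum_dot g' g' <= e ^+ 2 ->
  `|sum_dot g g'| <= e.
Proof.
move=> e0 g1 g'e.
have half f : sum_dot f f <= e ^+ 2 -> sum_dot g f <= e.
  (* The slack [d] keeps the weight in Young's inequality positive when [e = 0]. *)
  move=> fe; apply/ler_addgt0Pr => d d0; have ed : 0 < e + d by lra.
  rewrite -(ler_pM2l (ltr0n R 2)); apply: le_trans (sum_dot_young _ _ ed) _.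
  have : (e + d) * sum_dot g g <= e + d by rewrite ler_piMr// ltW.
  have : sum_dot f f / (e + d) <= e + d.
    rewrite ler_pdivrMr//; apply: (le_trans fe).
    by rewrite -expr2 lerXn2r ?nnegrE//; lra.
  lra.
rewrite ler_norml half// andbT lerNl -sum_dotNr half//.
have -> // : sum_dot (- g') (- g') = sum_dot g' g'.
by apply: eq_bigr => w _; rewrite fctE rdotNr rdotNl opprK.
Qed.

Lemma back_shift_bound m eps N h : (3 <= N)%N -> 0 <= eps ->
  Num.sqrt (opnorm (word_square_sum T m)) <= eps -> (m <= k * N.-1)%N ->
  sum_dot h h <= 1 ->
  sum_dot h (back_shift h) <= cos (pi / N%:R)
    + 3 * (pi * cos (pi / (2 * N%:R)) ^+ 4) `^ (1 / 3) * (eps / N%:R) `^ (2 / 3).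
Proof.
move=> N3 e0 le mk h1.
have pd : posdef_seq (fun j => sum_dot h (iter j back_shift h)).
  apply: posdef_contraction.
  - exact: back_shiftD.
  - by move=> a x; exact: back_shiftZ.
  - move=> x y z; rewrite /sum_dot -big_split; apply: eq_bigr => w _.
    by rewrite fctE rdotDl.
  - move=> a x z; rewrite /sum_dot mulr_sumr; apply: eq_bigr => w _.
    by rewrite fctE rdotZl.
  - by move=> x y; apply: eq_bigr => w _; rewrite rdotC.
  - exact: sum_dotxx_ge0.
  - exact: back_shift_contraction.
apply: (posdef_bound N3 pd h1 e0) => j Nj.
apply: sum_dot_le => //.
apply: le_trans (iter_back_shift_small h (j := j) le _) _.
  by apply: (leq_trans mk); rewrite leq_mul2l Nj orbT.
by rewrite ler_piMr ?sqr_ge0.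
Qed.

End BackwardShift.

(** * Passage to the unconditional sum over all words *)

Section Sums.
Local Open Scope classical_set_scope.
Local Open Scope complex_scope.
Local Open Scope ring_scope.
Context {R : realType} {J : finType}.

Lemma sum_sqr_words_le1 (f : seq J -> R) D : (forall w, 0 <= f w) ->
  \esum_(w in [set: seq J]) (f w)%:E = 1%E -> \sum_(w <- words_below D) f w <= 1.
Proof.
move=> f0 f1; rewrite -lee_fin -f1 -sumEFin; apply: esum_ge.
exists [set` words_below D]; last by rewrite fsbig_seq ?words_below_uniq.
by split; [exact: finite_seq | exact: subsetT].
Qed.

Lemma partial_sum_words (x : seq J -> R[i]) D :
  summability.partial_sum (R := R[i]^o) x (seq_fset tt (words_below D))
  = \sum_(w <- words_below D) x w.
Proof.
rewrite /summability.partial_sum.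
rewrite -(big_seq_fsetE _ (seq_fset tt (words_below D)) xpredT x) /=.
apply: etrans (perm_big _ (seq_fset_perm tt (words_below D))) _.
by rewrite (undup_id (words_below_uniq D)).
Qed.

Lemma rnorm_sum_le (x : seq J -> R[i]) (b : R) : 0 <= b ->
  (forall D, complex.Re `|\sum_(w <- words_below D) x w| <= b) ->
  rnorm (summability.sum (R := R[i]^o) x) <= b.
Proof.
move=> b0 xb; rewrite /summability.sum.
pose S := summability.partial_sum (R := R[i]^o) x.
have [cv|/dvgP ->] := pselect (cvg (S @ summability.totally)); last first.
  (* a divergent net has the junk limit 0 *)
  by rewrite /rnorm (_ : point = 0)// normr0.
set l := lim _ in cv *; rewrite leNgt; apply/negP => bl.
have e0 : 0 < (rnorm l - b)%:C by rewrite ltcR subr_gt0.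
have /(_ _ (nbhsx_ballx l _ e0)) [A _ AB] : S @ summability.totally --> l.
  exact: cv.
(* [D] exceeds the length of every word in [A], so [words_below D] contains [A]. *)
pose D := (\max_(w <- enum_fset A) size w).+1.
have : ball l (rnorm l - b)%:C
    (summability.partial_sum (R := R[i]^o) x (seq_fset tt (words_below D))).
  have AD : (A `<=` seq_fset tt (words_below D))%fset.
    apply/fsubsetP => w wA; rewrite seq_fsetE mem_words_below ltnS.
    exact: (leq_bigmax_seq (F := size)).
  exact: (AB _ AD).
rewrite partial_sum_words.
rewrite -ball_normE /= => lt.
have := xb D; set z := \sum_(w <- _) x w in lt *.
have : rnorm l <= complex.Re `|l - z| + complex.Re `|z|.
  by have := ler_normD (l - z) z; rewrite subrK lecE raddfD => /andP[].
by move: lt; rewrite ltcE /= => /andP[_]; lra.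
Qed.

End Sums.

Section Words.
Local Open Scope classical_set_scope.
Local Open Scope complex_scope.
Local Open Scope ring_scope.
Context {R : realType} {H : hilbertType R} {I : finType}.
Variables (T : I -> H -> H) (k : nat).
Hypotheses (Tb : forall i, bounded_operator (T i)) (Tr : row_contraction T).
Let J : finType := k.-tuple I.

Lemma sum_dot_back_shift (u : R[i]) (h : seq J -> H) D :
  sum_dot D.+1 h (back_shift T D.+1 u h) =
  complex.Re (u^* * \sum_(w <- words_below D) \sum_(j : J)
    ⟨ h w, word_operator T j (h (j :: w)) ⟩).
Proof.
rewrite /sum_dot /rdot mulr_sumr raddf_sum /= big_cat /=.
(* With cutoff [D.+1], words of length [D] contribute nothing because their extensions are cut,
   while shorter words keep all their terms. *)
rewrite [X in _ + X]big1_seq ?addr0 => [|w /= /mapP [t _ ->]]; last first.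
  rewrite /back_shift big1 => [|j _]; first by rewrite scaler0 linear0r.
  by rewrite /cut /= size_tuple ltnn (linear0_of (proj1 (bounded_word Tb j))).
apply: eq_big_seq => w; rewrite mem_words_below => wD.
rewrite /back_shift dotZr linear_sumr; congr (complex.Re (_ * _)).
by apply: eq_bigr => j _; rewrite /cut /= ltnS wD.
Qed.

Lemma partial_numerical_radius m eps N (h : seq J -> H) D : (3 <= N)%N -> 0 <= eps ->
  Num.sqrt (opnorm (word_square_sum T m)) <= eps -> (m <= k * N.-1)%N ->
  sum_dot D.+1 h h <= 1 ->
  complex.Re `|\sum_(w <- words_below D) \sum_(j : J)
    ⟨ h w, word_operator T j (h (j :: w)) ⟩|
  <= cos (pi / N%:R)
    + 3 * (pi * cos (pi / (2 * N%:R)) ^+ 4) `^ (1 / 3) * (eps / N%:R) `^ (2 / 3).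
Proof.
move=> N3 e0 le mk h1; set z := \sum_(w <- _) _; set b := (X in _ <= X).
have [r r0 zr] : exists2 r : R, 0 <= r & `|z| = r%:C.
  have := normr_ge0 z; case: `|z| => r i.
  by rewrite lecE /= => /andP[/eqP -> r0]; exists r.
rewrite zr /=.
have zz : z^* * z = (r ^+ 2)%:C by rewrite mulrC -normCK zr rmorphXn.
have [->|rn] := eqVneq r 0.
  rewrite /b addr_ge0 ?cos_pi_div_ge0// mulr_ge0 ?powR_ge0// mulr_ge0 ?powR_ge0//.
(* Rotating by the phase of [z] turns the real part in [sum_dot_back_shift] into the modulus of
   [z]. *)
pose u := (r^-1)%:C * z.
have rV0 : 0 <= (r^-1)%:C by rewrite lecR invr_ge0.
have u1 : complex.Re `|u| <= 1.
  by rewrite normrM zr (ger0_norm rV0) -rmorphM mulVf.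
have uz : u^* * z = r%:C.
  have -> : u^* = (r^-1)%:C * z^*.
    by rewrite rmorphM; congr (_ * _); apply/eqP; rewrite eq_complex /= oppr0 !eqxx.
  by rewrite -mulrA zz -rmorphM expr2 mulKf.
have := back_shift_bound Tb Tr u1 N3 e0 le mk h1.
by rewrite sum_dot_back_shift -/z uz.
Qed.

End Words.

Theorem theorem7p12 (R : realType) (H : hilbertType R) (n m : nat) (eps : R)
    (T : 'I_n -> H -> H) (k : nat) :
  (1 <= n)%N -> (2 <= m)%N -> 0 <= eps ->
  (forall i, bounded_operator (T i)) ->
  row_contraction T ->
  Num.sqrt (opnorm (word_square_sum T m)) <= eps ->
  (\sum_(0 <= j <oo) (Num.sqrt (opnorm (word_square_sum T j)))%:E < +oo)%E ->
  (1 <= k <= m - 1)%N ->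
  let N : R := ((m - 1) %/ k + 2)%:R in
  (joint_numerical_radius (fun alpha : k.-tuple 'I_n => word_operator T alpha)
   <= (cos (pi / N)
       + 3 * (pi * cos (pi / (2 * N)) ^+ 4) `^ (1 / 3)
           * (eps / N) `^ (2 / 3))%:E)%E.
Proof.
move=> _ m2 e0 Tb Tr le _ /andP[k1 km] /=.
set N := ((m - 1) %/ k + 2)%N.
have q1 : (0 < (m - 1) %/ k)%N by rewrite divn_gt0.
have N3 : (3 <= N)%N by rewrite /N; lia.
(* [N - 1] is the least exponent whose words, of length [k * (N - 1)], reach length [m]. *)
have mk : (m <= k * N.-1)%N.
  rewrite /N addn2 /= mulnC; have := ltn_ceil (m - 1) k1.
  by move: ((m - 1) %/ k).+1 => q; lia.
apply: ge_ereal_sup => _ [h /= h1 <-]; rewrite lee_fin.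
apply: rnorm_sum_le => [|D].
  by rewrite addr_ge0 ?cos_pi_div_ge0// mulr_ge0 ?powR_ge0// mulr_ge0 ?powR_ge0.
apply: (partial_numerical_radius Tb Tr N3 e0 le mk).
rewrite /sum_dot; under eq_bigr do rewrite rdotxx.
by apply: sum_sqr_words_le1 h1 => w; exact: sqr_ge0.
Qed.
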